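(* Let $\ell,n$ be positive integers with $\ell\le n$, and let $\Delta_{\ell,n}=\{x\in[0,1]^n : x_1+\cdots+x_n=\ell\}$ be the $(\ell,n)$-hypersimplex. Then the harmonic algebra $\mathcal{H}_{\Delta_{\ell,n}}$ is generated as a $\mathbb{Q}$-algebra by its component of $x_0$-degree $1$, i.e. by $x_0\cdot V_{\Delta_{\ell,n}}$. In particular, $\mathcal{H}_{\Delta_{\ell,n}}$ is a finitely generated $\mathbb{Q}$-algebra.
   Context: Let $S=\mathbb{Q}[x_1,\dots,x_n]$ with the standard grading. For nonzero $f\in S$ let $\tau(f)$ be its top-degree homogeneous component. For a finite set $Z\subset\mathbb{Z}^n$ let $I(Z)\subseteq S$ be the ideal of polynomials vanishing on $Z$, and $\operatorname{gr}I(Z)=\langle\tau(f):0\ne f\in I(Z)\rangle$. For $f,g\in S$ put $f\odot g=f(\partial/\partial x_1,\dots,\partial/\partial x_n)\,g$. For a homogeneous ideal $I\subseteq S$ let $I^\perp=\{g\in S: f\odot g=0\text{ for all }f\in I\}$. For a lattice polytope $\mathsf{P}\subset\mathbb{R}^n$ the harmonic space is $V_{\mathsf{P}}=(\operatorname{gr}I(\mathsf{P}\cap\mathbb{Z}^n))^\perp\subseteq S$. With $m\mathsf{P}=\{mp:p\in\mathsf{P}\}$, the harmonic algebra of $\mathsf{P}$ is $$\mathcal{H}_{\mathsf{P}}=\bigoplus_{m\ge0} x_0^m\cdot V_{m\mathsf{P}}\subseteq \mathbb{Q}[x_0,x_1,\dots,x_n],$$ which is known to be a $\mathbb{Q}$-subalgebra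 of $\mathbb{Q}[x_0,x_1,\dots,x_n]$; the $x_0$-degree $m$ component is $x_0^m V_{m\mathsf{P}}$. *)

(* Defs.v *)
From HB Require Import structures.
From mathcomp Require Import all_boot all_order all_algebra.
From mathcomp Require Import mpoly.
From mathcomp Require Import reals.

Set Implicit Arguments.
Unset Strict Implicit.
Unset Printing Implicit Defensive.

Import GRing.Theory Num.Theory.
Local Open Scope ring_scope.

Definition is_ideal (A : comNzRingType) (J : A -> Prop) : Prop :=
  [/\ J 0, forall a b, J a -> J b -> J (a + b) & forall c a, J a -> J (c * a)].

Definition ideal_gen (A : comNzRingType) (G : A -> Prop) (a : A) : Prop :=
  forall J : A -> Prop, is_ideal J -> (forall g, G g -> J g) -> J a.

Definition is_subalgebra (K : fieldType) (A : algType K) (B : A -> Prop) : Prop :=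
  [/\ B 1, forall (c : K) a, B a -> B (c *: a),
      forall a b, B a -> B b -> B (a + b) & forall a b, B a -> B b -> B (a * b)].

Definition algebra_gen (K : fieldType) (A : algType K) (G : A -> Prop) (a : A) :
    Prop :=
  forall B : A -> Prop, is_subalgebra B -> (forall g, G g -> B g) -> B a.

Definition generated_as_algebra_by (K : fieldType) (A : algType K)
    (H G : A -> Prop) : Prop :=
  forall a, H a <-> algebra_gen G a.

Definition finitely_generated_algebra (K : fieldType) (A : algType K)
    (H : A -> Prop) : Prop :=
  exists s : seq A, generated_as_algebra_by H (fun a => a \in s).

Section Harmonic.

Variable n : nat.
Local Notation S := {mpoly rat[n]}.

Definition top_component (f : S) : S := pihomog mdeg (msize f).-1 f.

Definition vanishing_ideal (Z : 'rV[int]_n -> Prop) (f : S) : Prop :=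
  forall z, Z z -> f.@[fun i => (z 0 i)%:~R] = 0.

Definition gr_ideal (Z : 'rV[int]_n -> Prop) : S -> Prop :=
  ideal_gen (fun h =>
    exists f, [/\ f != 0, vanishing_ideal Z f & h = top_component f]).

Definition diff_action (f g : S) : S := \sum_(m <- msupp f) f@_m *: g^`M[m].

Definition perp (I : S -> Prop) (g : S) : Prop :=
  forall f, I f -> diff_action f g = 0.

Section Polytope.

Variable R : realType.

Definition lattice_points (P : 'rV[R]_n -> Prop) (z : 'rV[int]_n) : Prop :=
  P (map_mx intr z).

Definition dilate (m : nat) (P : 'rV[R]_n -> Prop) (x : 'rV[R]_n) : Prop :=
  exists2 p, P p & x = m%:R *: p.

Definition harmonic_space (P : 'rV[R]_n -> Prop) : S -> Prop :=
  perp (gr_ideal (lattice_points P)).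

(* The inclusion Q[x_1, ..., x_n] -> Q[x_0, ..., x_n]: the variable x_j of the
   text is ['X_j] in the target, and ['X_(j - 1)] in the source. *)
Definition embed (f : S) : {mpoly rat[n.+1]} :=
  f \mPo [tuple 'X_(lift ord0 i) | i < n].

Definition harmonic_component (P : 'rV[R]_n -> Prop) (m : nat)
    (F : {mpoly rat[n.+1]}) : Prop :=
  exists2 v, harmonic_space (dilate m P) v & F = 'X_ord0 ^+ m * embed v.

Definition harmonic_algebra (P : 'rV[R]_n -> Prop) (F : {mpoly rat[n.+1]}) :
    Prop :=
  exists (d : nat) (G : nat -> {mpoly rat[n.+1]}),
    (forall m, harmonic_component P m (G m)) /\ F = \sum_(m < d) G m.

Definition hypersimplex (l : nat) (x : 'rV[R]_n) : Prop :=
  (forall i, 0 <= x 0 i <= 1) /\ \sum_i x 0 i = l%:R.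

Lemma harmonic_component1 (P : 'rV[R]_n -> Prop) (F : {mpoly rat[n.+1]}) :
  harmonic_component P 1 F <->
  exists2 v, harmonic_space P v & F = 'X_ord0 * embed v.
Proof.
have dil1 z : lattice_points (dilate 1 P) z <-> lattice_points P z.
  rewrite /lattice_points /dilate; split=> [[p Pp ->]|Pz]; first by rewrite scale1r.
  by exists (map_mx intr z) => //; rewrite scale1r.
have gr_eq f : gr_ideal (lattice_points (dilate 1 P)) f <->
               gr_ideal (lattice_points P) f.
  split=> If J idJ GJ; apply: If => // h [g [g0 gZ ->]]; apply: GJ; exists g.
    by split=> // z /dil1; apply: gZ.
  by split=> // z /dil1; apply: gZ.
by split=> -[v Vv ->]; exists v; rewrite ?expr1 // => f /gr_eq; apply: Vv.
Qed.

End Polytope.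

End Harmonic.

(* Main.v *)
(* A homogeneous form g of degree d lies in the harmonic space of Z as soon as
   it agrees, on forms of degree d, with a combination of evaluations at points
   of Z that kills all polynomials of degree less than d.  For a multigraph E on
   {1, ..., n}, the iterated difference operator prod_(ij in E) (T_i - T_j)
   followed by a suitable evaluation is such a combination, with g the product
   of the x_i - x_j over the edges ij of E; the points lie in the m-th dilate of
   the hypersimplex when all degrees of E are at most m and E has at most m h
   edges, where h = min(l, n - l).

   Conversely, explicit elements of the vanishing ideal show that a harmonic
   polynomial has degree at most m in each variable, total degree at most m h,
   and is translation invariant, and such polynomials are combinations of these
   graph monomials.

   To factor a graph monomial into m graph monomials of matchings, split the
   vertices into the first h and the remaining ones.  Following Kempe, Plücker
   relations rewrite it as a combination of monomials of bipartite multigraphs of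
   maximal degree at most m, and Kőnig's theorem colours the edges of these with
   m colours; each colour class is a matching with at most h edges. *)
Require Import Defs.
From mathcomp Require Import all_boot all_order all_algebra.
From mathcomp Require Import mpoly reals ring zify.

Set Implicit Arguments.
Unset Strict Implicit.
Unset Printing Implicit Defensive.

Import Order.TTheory GRing.Theory Num.Theory.

(** * Edge colouring of bipartite multigraphs *)

Section Koenig.

Variables S T : eqType.
Implicit Types (M N E : seq (S * T)) (a : S) (b : T).

(** The two coordinates are separate vertex sets, so one type may serve for both sides of the
    graph. *)
Definition bimatching M := uniq (unzip1 M) && uniq (unzip2 M).

Lemma bimatching_cons a b M :
  bimatching ((a, b) :: M) =
  [&& a \notin unzip1 M, b \notin unzip2 M & bimatching M].
Proof. by rewrite /bimatching /= andbACA -andbA. Qed.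

Lemma perm_bimatching M N : perm_eq M N -> bimatching M = bimatching N.
Proof.
by move=> pMN; rewrite /bimatching !(perm_uniq (perm_map _ pMN)).
Qed.

Lemma perm_cat2_cons (U : eqType) (x y : U) (r s t : seq U) :
  perm_eq (r ++ s) t -> perm_eq ((x :: r) ++ y :: s) (x :: y :: t).
Proof.
move=> p; rewrite /= perm_cons -(perm_cat2l [:: y]) /= in p *.
by apply: perm_trans p; rewrite -cat1s perm_catCA.
Qed.

(* Follows the alternating path that starts with the new edge. The vertex [a]
   is not on the rest of the path, which the inclusion of the [S]-vertices
   records. *)
Lemma insert_edge_two_matchings M1 M2 a b :
    bimatching M1 -> bimatching M2 -> a \notin unzip1 M1 ->
    b \notin unzip2 M2 ->
  exists N1 N2,
    [/\ bimatching N1, bimatching N2, perm_eq (N1 ++ N2) ((a, b) :: M1 ++ M2),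
        a \in unzip1 N1 & {subset unzip1 N1 <= a :: unzip1 M1}].
Proof.
have [k] := ubnP (size M1).
elim: k M1 M2 a b => // k IHk M1 M2 a b ltM1 mM1 mM2 aM1 bM2.
have [bM1|] := boolP (b \in unzip2 M1); last first.
  move=> bM1; exists ((a, b) :: M1), M2.
  by rewrite bimatching_cons aM1 bM1 mM1 mem_head; split.
have /mapP[[a' b0] eM1 /= eb] := bM1; subst b0.
have := perm_to_rem eM1; set M1' := rem _ _ => pM1.
have := mM1; rewrite (perm_bimatching pM1) bimatching_cons.
case/and3P=> a'M1' bM1' mM1'.
have in1 x : (x \in unzip1 M1) = (x == a') || (x \in unzip1 M1').
  by rewrite (perm_mem (perm_map _ pM1)) inE.
have [ne_a aM1'] : a != a' /\ a \notin unzip1 M1'.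
  by apply/andP; rewrite -negb_or -in1.
have pMM : perm_eq ((a, b) :: (a', b) :: M1' ++ M2) ((a, b) :: M1 ++ M2).
  by rewrite perm_cons -cat_cons perm_cat2r perm_sym.
(* If [a'] is free in [M2], the edge [(a', b)] moves there and makes room for [(a, b)]. *)
have [a'M2|a'M2] := boolP (a' \in unzip1 M2); last first.
  exists ((a, b) :: M1'), ((a', b) :: M2).
  rewrite !bimatching_cons a'M2 bM2 bM1' aM1' mM1' mM2 mem_head; split=> //.
    exact: perm_trans (perm_cat2_cons _ _ (perm_refl _)) pMM.
  by move=> x; rewrite /= !inE in1 => /orP[->|->]; rewrite ?orbT.
have /mapP[[a0 b'] eM2 /= ea] := a'M2; subst a0.
have := perm_to_rem eM2; set M2' := rem _ _ => pM2.
have := mM2; rewrite (perm_bimatching pM2) bimatching_cons.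
case/and3P=> a'M2' b'M2' mM2'.
have in2 x : (x \in unzip2 M2) = (x == b') || (x \in unzip2 M2').
  by rewrite (perm_mem (perm_map _ pM2)) inE.
have [ne_b bM2'] : b != b' /\ b \notin unzip2 M2'.
  by apply/andP; rewrite -negb_or -in2.
have ltM1' : size M1' < k by move: ltM1; rewrite (perm_size pM1).
(* Otherwise [(a', b')] leaves [M2] and is inserted next to [M1'], which frees [a'] for the edge
   [(a', b)]. *)
have [N1 [N2 [mN1 mN2 pN a'N1 sN1]]] := IHk _ _ _ _ ltM1' mM1' mM2' a'M1' b'M2'.
have aN1 : a \notin unzip1 N1.
  by apply: contra aM1 => /sN1; rewrite inE in1.
have /norP[bN1 bN2] : ~~ ((b \in unzip2 N1) || (b \in unzip2 N2)).
  rewrite -mem_cat -map_cat (perm_mem (perm_map _ pN)) /= inE map_cat mem_cat.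
  by rewrite (negPf ne_b) (negPf bM1') (negPf bM2').
(* Only one edge of [N1 ++ N2] meets [a'], and it lies in [N1]. *)
have a'N2 : a' \notin unzip1 N2.
  have := permP (perm_map (@fst _ _) pN) (pred1 a').
  rewrite /= eqxx !map_cat !count_cat (count_memPn a'M1') (count_memPn a'M2').
  move=> eqc; apply/count_memPn; move: a'N1 eqc; rewrite -has_pred1 has_count.
  by case: count => // c _ [/eqP]; rewrite addn_eq0 => /andP[_ /eqP].
exists ((a, b) :: N1), ((a', b) :: N2).
rewrite !bimatching_cons a'N2 bN2 bN1 aN1 mN1 mN2 mem_head; split=> //.
  apply: perm_trans (perm_cat2_cons _ _ pN) _.
  apply: perm_trans pMM; rewrite !perm_cons -cat1s perm_catCA perm_cat2l perm_sym.
  exact: pM2.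
move=> x; rewrite /= !inE in1 => /orP[->//|/sN1].
by rewrite inE => ->; rewrite orbT.
Qed.

(** Pigeonhole: every block whose image contains [x] contributes to the count. This yields a colour
    that is missing at a given vertex. *)
Lemma exists_avoiding_block (U V : eqType) (f : U -> V) (Ms : seq (seq U)) x :
    count_mem x (map f (flatten Ms)) < size Ms ->
  exists2 M, M \in Ms & x \notin map f M.
Proof.
elim: Ms => //= M Ms IHM; rewrite map_cat count_cat.
have [xM|xM] := boolP (x \in map f M); last by exists M; rewrite ?mem_head.
move=> lt; have [|N NMs xN] := IHM; last by exists N; rewrite // inE NMs orbT.
move: xM; rewrite -has_pred1 has_count => c_gt0; rewrite -ltnS.
by apply: leq_trans lt; rewrite ltnS -add1n leq_add2r.
Qed.

(** Edges are coloured one at a time. The new edge counts towards the degrees of its ends, so some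
    class misses [a] and some class misses [b]; an exchange between these two makes room. Classes
    may be empty. *)
Theorem bipartite_edge_colouring m E :
    (forall a, count_mem a (unzip1 E) <= m) ->
    (forall b, count_mem b (unzip2 E) <= m) ->
  exists Ms, [/\ size Ms = m, all bimatching Ms & perm_eq (flatten Ms) E].
Proof.
elim: E => [|[a b] E IHE] dS dT.
  exists (nseq m [::]); rewrite size_nseq all_nseq orbT; split=> //.
  by elim: m {dS dT} => //= m ->.
have [|| Ms [sMs aMs pMs]] := IHE.
- by move=> x; apply: leq_trans (dS x); rewrite /= leq_addl.
- by move=> x; apply: leq_trans (dT x); rewrite /= leq_addl.
have [|M1 M1s aM1] := @exists_avoiding_block _ _ (@fst S T) Ms a.
  by rewrite (permP (perm_map _ pMs)) sMs; have := dS a; rewrite /= eqxx.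
have [|M2 M2s bM2] := @exists_avoiding_block _ _ (@snd S T) Ms b.
  by rewrite (permP (perm_map _ pMs)) sMs; have := dT b; rewrite /= eqxx.
have pM1 := perm_to_rem M1s; set R1 := rem _ _ in pM1.
have mM1 := allP aMs _ M1s; have mM2 := allP aMs _ M2s.
have aR1 : all bimatching R1.
  by apply/allP => M MR; apply: (allP aMs); rewrite (perm_mem pM1) inE MR orbT.
have [bM1|bM1] := boolP (b \in unzip2 M1); last first.
  exists (((a, b) :: M1) :: R1).
  rewrite -sMs (perm_size pM1) /= bimatching_cons aM1 bM1 mM1 aR1; split=> //.
  rewrite perm_cons; apply: perm_trans pMs.
  by rewrite perm_sym; apply: (perm_flatten pM1).
(* [b] lies on [M1] but not on [M2], so the two classes differ. *)
have M2R : M2 \in R1.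
  move: M2s; rewrite (perm_mem pM1) inE => /orP[/eqP eM|//].
  by rewrite eM bM1 in bM2.
have pM2 := perm_to_rem M2R; set R2 := rem _ _ in pM2.
have aR2 : all bimatching R2.
  by apply/allP => M MR; apply: (allP aR1); rewrite (perm_mem pM2) inE MR orbT.
have [N1 [N2 [mN1 mN2 pN _ _]]] := insert_edge_two_matchings mM1 mM2 aM1 bM2.
exists [:: N1, N2 & R2].
rewrite -sMs (perm_size pM1) /= (perm_size pM2) /= mN1 mN2 aR2; split=> //.
rewrite catA (permPl (perm_cat pN (perm_refl _))) cat_cons perm_cons.
apply: perm_trans pMs; rewrite perm_sym.
rewrite (permPl (perm_flatten pM1)) /= -catA perm_cat2l.
exact: (perm_flatten pM2).
Qed.

End Koenig.

(** * Linear spans *)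

Section LinearSpan.

Local Open Scope ring_scope.
Variables (K : nzRingType) (V : lmodType K).
Implicit Types (W G : V -> Prop).

Definition is_subspace W : Prop :=
  [/\ W 0, forall a b, W a -> W b -> W (a + b) & forall c a, W a -> W (c *: a)].

(** As the intersection of all subspaces containing [G], the span is its own induction principle: a
    membership proof is applied to the predicate to be shown. *)
Definition lspan G (a : V) : Prop :=
  forall W, is_subspace W -> (forall g, G g -> W g) -> W a.

Lemma mem_lspan G g : G g -> lspan G g.
Proof. by move=> Gg W _; apply. Qed.

Lemma lspan_subspace G : is_subspace (lspan G).
Proof.
split=> [|a b Ga Gb|c a Ga] W WW GW; have [W0 WD WZ] := WW => //.
  by apply: WD; [apply: Ga|apply: Gb].
by apply: WZ; apply: Ga.
Qed.

Lemma lspan_trans G1 G2 a :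
  lspan G1 a -> (forall g, G1 g -> lspan G2 g) -> lspan G2 a.
Proof. by move=> G1a; apply: G1a; apply: lspan_subspace. Qed.

Lemma subspaceB W a b : is_subspace W -> W a -> W b -> W (a - b).
Proof.
by case=> _ WD WZ Wa Wb; apply: WD => //; rewrite -scaleN1r; apply: WZ.
Qed.

Lemma subspace_sum W (I : Type) (r : seq I) (P : pred I) F :
  is_subspace W -> (forall i, P i -> W (F i)) -> W (\sum_(i <- r | P i) F i).
Proof. by case=> W0 WD _ WF; apply: big_ind. Qed.

End LinearSpan.

(** * Graph monomials *)

Section GraphMonomial.

Local Open Scope ring_scope.
Variable n : nat.
Local Notation S := {mpoly rat[n]}.
Local Notation V := 'I_n.
Implicit Types (E : seq (V * V)) (k : V).

Definition graph_monomial E : S := \prod_(e <- E) ('X_(e.1) - 'X_(e.2)).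

(* A loop counts twice. *)
Definition vdeg E k := (count_mem k (unzip1 E) + count_mem k (unzip2 E))%N.

Lemma graph_monomial_cons e E :
  graph_monomial (e :: E) = ('X_(e.1) - 'X_(e.2)) * graph_monomial E.
Proof. by rewrite /graph_monomial big_cons. Qed.

Lemma graph_monomial_cat E1 E2 :
  graph_monomial (E1 ++ E2) = graph_monomial E1 * graph_monomial E2.
Proof. by rewrite /graph_monomial big_cat. Qed.

Lemma perm_graph_monomial E1 E2 :
  perm_eq E1 E2 -> graph_monomial E1 = graph_monomial E2.
Proof. by move=> pE; rewrite /graph_monomial (perm_big _ pE). Qed.

Lemma vdeg_cons e E k :
  vdeg (e :: E) k = ((e.1 == k) + (e.2 == k) + vdeg E k)%N.
Proof. by rewrite /vdeg /= addnACA. Qed.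

Lemma vdeg_cat E1 E2 k : vdeg (E1 ++ E2) k = (vdeg E1 k + vdeg E2 k)%N.
Proof. by rewrite /vdeg /unzip1 /unzip2 !map_cat !count_cat addnACA. Qed.

Lemma perm_vdeg E1 E2 k : perm_eq E1 E2 -> vdeg E1 k = vdeg E2 k.
Proof.
move=> pE; rewrite /vdeg (permP (perm_map fst pE)).
by rewrite (permP (perm_map snd pE)).
Qed.

(** Both bounds are additive in [m] under concatenation of graphs, which matches multiplication in
    the algebra. *)
Definition bounded_graph (h m : nat) E :=
  (size E <= m * h)%N /\ forall k, (vdeg E k <= m)%N.

End GraphMonomial.

(** * Kempe's reduction to matchings *)

Section Kempe.

Local Open Scope ring_scope.
Variables (n h m : nat).
Hypothesis le_hn : (h.*2 <= n)%N.
Local Notation S := {mpoly rat[n]}.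
Local Notation V := 'I_n.
Implicit Types (E : seq (V * V)) (k : V) (e : V * V).

(** Both sides have at least [h] vertices because [h.*2 <= n]; the first has exactly [h], which
    later limits the size of matchings. *)
Let side k := (k < h)%N.
Let bad e := side e.1 == side e.2.

Lemma leq_card_side (s : bool) : (h <= #|[pred k : V | side k == s]|)%N.
Proof.
have le_h : (h <= n)%N by rewrite (leq_trans _ le_hn) // -addnn leq_addr.
have cardA : #|[pred k : V | side k]| = h.
  by rewrite -sum1_card (big_ord_narrow le_h) sum1_card card_ord.
case: s.
  apply: leq_trans (eq_leq (esym cardA)) _.
  by apply/eq_leq/eq_card => k; rewrite !inE eqb_id.
have := cardC [pred k : V | side k]; rewrite cardA card_ord => eqn.
rewrite (@eq_card _ _ [predC [pred k : V | side k]]) => [|k].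
  by rewrite -(leq_add2l h) eqn addnn.
by rewrite !inE; case: (side k).
Qed.

Lemma sum_nat_eq_indicator (P : pred V) k0 :
  (\sum_(k | P k) (k0 == k) = P k0)%N.
Proof.
have [Pk|nPk] := boolP (P k0).
  rewrite (bigD1 k0) //= eqxx big1 // => k /andP[_ /negPf nk].
  by rewrite eq_sym nk.
by rewrite big1 // => k Pk; case: eqP => // ek; rewrite ek Pk in nPk.
Qed.

(** Double counting of the edge ends on one side. *)
Lemma sum_vdeg_side (s : bool) E :
  (\sum_(k | side k == s) vdeg E k =
   \sum_(e <- E) ((side e.1 == s) + (side e.2 == s)))%N.
Proof.
elim: E => [|e E IHE]; first by rewrite big_nil big1.
under eq_bigr do rewrite vdeg_cons.
rewrite big_cons -IHE !big_split /=.
by rewrite !(sum_nat_eq_indicator (fun k => side k == s)).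
Qed.

(* If every vertex of the side opposite to a bad edge is saturated and that
   side carries no bad edge, then each edge has at most one end there, so the
   graph has more than [m * h] edges. *)
Lemma bad_edge_partner e E : bounded_graph h m (e :: E) -> bad e ->
  (exists2 k, side k != side e.1 & (vdeg (e :: E) k < m)%N) \/
  (exists2 f, f \in E & bad f && (side f.1 != side e.1)).
Proof.
move=> [sE _] be.
have [/existsP[k /andP[]]|/existsPn sat] :=
  boolP [exists k, (side k != side e.1) && (vdeg (e :: E) k < m)%N].
  by left; exists k.
have [/hasP[f fE]|/hasPn nbad] :=
  boolP (has (fun f => bad f && (side f.1 != side e.1)) E).
  by right; exists f.
have := leq_card_side (~~ side e.1); rewrite -(leq_pmul2l (m := m)); last first.
  by case: (m) sE.
rewrite -sum1_card big_distrr /= leqNgt => /negP[].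
apply: leq_trans sE.
apply: (@leq_ltn_trans (\sum_(k | side k == ~~ side e.1) vdeg (e :: E) k)%N).
  apply: leq_sum => k; rewrite inE muln1 => /eqP sk.
  by have := sat k; rewrite sk negb_and -leqNgt; case: (side e.1).
rewrite sum_vdeg_side big_cons (eqP (be : side e.1 == side e.2)).
rewrite (_ : side e.2 == _ = false); last by case: (side e.2).
rewrite /= ltnS -sum1_size !big_seq; apply: leq_sum => f fE.
have := nbad f fE; rewrite /bad (eqP (be : side e.1 == side e.2)).
by case: (side f.1) (side f.2) (side e.2) => [] [] [].
Qed.

(** Two relations replace the bad edge by edges across: [x_i - x_j = (x_i - x_k) - (x_j - x_k)] if a
    vertex [k] of the other side has degree to spare, and otherwise the Plücker relation with a bad
    edge of the other side, which preserves all degrees. *)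
Lemma kempe_step e E : bounded_graph h m (e :: E) -> bad e ->
  exists E1 E2, [/\ graph_monomial (e :: E) = graph_monomial E1 - graph_monomial E2,
    bounded_graph h m E1 /\ (count bad E1 <= count bad E)%N &
    bounded_graph h m E2 /\ (count bad E2 <= count bad E)%N].
Proof.
move=> bE be; have [sE dE] := bE.
case: (bad_edge_partner bE be) => [[k sk dk]|[f fE /andP[bf sf]]].
  exists ((e.1, k) :: E), ((e.2, k) :: E); split.
  - by rewrite !graph_monomial_cons /=; ring.
  - split; last first.
      by rewrite /= /bad /= eq_sym (negPf sk).
    split=> // j; rewrite vdeg_cons /=; have [<-|nkj] := eqVneq k j.
      by rewrite vdeg_cons in dk; apply: leq_trans dk; rewrite addn1 addSn ltnS; lia.
    by have := dE j; rewrite vdeg_cons; lia.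
  - have se : side e.1 = side e.2 := eqP be.
    split; last by rewrite /= /bad /= -se eq_sym (negPf sk).
    split=> // j; rewrite vdeg_cons /=; have [<-|nkj] := eqVneq k j.
      by rewrite vdeg_cons in dk; apply: leq_trans dk; rewrite addn1 addSn ltnS; lia.
    by have := dE j; rewrite vdeg_cons; lia.
have pE := perm_to_rem fE; set E' := rem _ _ in pE.
have se : side e.1 = side e.2 := eqP be.
have sff : side f.1 = side f.2 := eqP bf.
exists [:: (e.1, f.1), (e.2, f.2) & E'], [:: (e.1, f.2), (e.2, f.1) & E'].
split.
- rewrite graph_monomial_cons (perm_graph_monomial pE) !graph_monomial_cons /=.
  by ring.
- split; last first.
    rewrite (permP pE) /= /bad /= -se -sff (eq_sym (side e.1)) (negPf sf).
    by rewrite leq_addl.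
  split=> [|k]; first by move: sE; rewrite /= (perm_size pE).
  have := dE k; rewrite vdeg_cons (perm_vdeg k pE) !vdeg_cons /=; lia.
- split; last first.
    rewrite (permP pE) /= /bad /= -se -sff (eq_sym (side e.1)) (negPf sf).
    by rewrite leq_addl.
  split=> [|k]; first by move: sE; rewrite /= (perm_size pE).
  have := dE k; rewrite vdeg_cons (perm_vdeg k pE) !vdeg_cons /=; lia.
Qed.

Lemma perm_bounded_graph E1 E2 :
  perm_eq E1 E2 -> bounded_graph h m E1 -> bounded_graph h m E2.
Proof.
move=> pE [sE dE]; split=> [|k]; first by rewrite -(perm_size pE).
by rewrite -(perm_vdeg k pE).
Qed.

(** Induction on the number of bad edges, which each relation lowers. *)
Lemma span_bipartite E : bounded_graph h m E ->
  lspan (fun g => exists E', [/\ bounded_graph h m E',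
           all (fun e => (e.1 < h <= e.2)%N) E' & g = graph_monomial E'])
        (graph_monomial E).
Proof.
have [c] := ubnP (count bad E); elim: c E => // c IHc E.
have [/hasP[e eE be]|/hasPn nbad _] := boolP (has bad E).
  have pE := perm_to_rem eE; rewrite (permP pE) /= be ltnS => ltc.
  move/(perm_bounded_graph pE); rewrite (perm_graph_monomial pE) => bE.
  have [E1 [E2 [-> [b1 c1] [b2 c2]]]] := kempe_step bE be.
  apply: (subspaceB (@lspan_subspace _ _ _)).
    by apply: IHc => //; apply: leq_ltn_trans ltc.
  by apply: IHc => //; apply: leq_ltn_trans ltc.
move=> [sE dE].
(* Without bad edges it remains to orient every edge away from the first side; each reversal changes
   the sign. *)
pose flip e : V * V := if side e.1 then e else (e.2, e.1).
pose W := lspan (fun g => exists E', [/\ bounded_graph h m E',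
           all (fun e => (e.1 < h <= e.2)%N) E' & g = graph_monomial E']).
have [_ _ WZ] : is_subspace W by apply: lspan_subspace.
have [c0 ->] : exists c0, graph_monomial E = c0 *: graph_monomial (map flip E).
  elim: (E) => [|e E' [c1 eqc]]; first by exists 1; rewrite scale1r.
  rewrite /= !graph_monomial_cons eqc /flip; case: ifP => _.
    by exists c1; rewrite scalerAr.
  by exists (- c1) => /=; rewrite -scalerAr scaleNr -scalerN -mulNr opprB.
apply: WZ; apply: mem_lspan; exists (map flip E); split=> //.
  split=> [|k]; first by rewrite size_map.
  apply: leq_trans (dE k); apply/eq_leq; elim: (E) => //= e E' IH.
  by rewrite !vdeg_cons IH /flip; case: ifP => _ //=; rewrite (addnC (e.2 == k)).
apply/allP => _ /mapP[e eE ->]; have := nbad e eE.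
by rewrite /flip /bad /side; case: ifP => s1 /=; rewrite !(leqNgt h) s1; case: ltnP.
Qed.

Lemma span_matching_products E : bounded_graph h m E ->
  lspan (fun g => exists Ms, [/\ size Ms = m,
           forall M, M \in Ms -> bounded_graph h 1 M
           & g = \prod_(M <- Ms) graph_monomial M])
        (graph_monomial E).
Proof.
move/span_bipartite/lspan_trans; apply=> {E}_ [E [[sE dE] oE ->]].
have [a|b|Ms [sM mM pM]] := @bipartite_edge_colouring _ _ m E.
- exact: leq_trans (leq_addr _ _) (dE a).
- exact: leq_trans (leq_addl _ _) (dE b).
apply: mem_lspan; exists Ms; split=> //; last first.
  by rewrite -(perm_graph_monomial pM) /graph_monomial big_flatten.
move=> M MMs; have /andP[u1 u2] := allP mM M MMs.
have oM : {in M, forall e, (e.1 < h <= e.2)%N}.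
  move=> e eM; apply: (allP oE); rewrite -(perm_mem pM).
  by apply/flattenP; exists M.
split=> [|k].
  (* The first ends of a matching are distinct vertices below [h]. *)
  rewrite mul1n -(size_map fst) -(size_map val) -[leqRHS](size_iota 0 h).
  apply: uniq_leq_size; first by rewrite (map_inj_uniq val_inj).
  move=> _ /mapP[_ /mapP[e eM ->] ->]; rewrite mem_iota add0n leq0n /=.
  by case/andP: (oM e eM).
rewrite /vdeg !count_uniq_mem //.
have [/mapP[e eM ->]|_] := boolP (k \in _); last by case: (_ \in _).
(* First ends lie below [h] and second ends do not, so no vertex is both. *)
rewrite (_ : (_ \in unzip2 M) = false) //; apply/negP => /mapP[f fM ef].
by have [/andP[lt1 _] /andP[_]] := (oM e eM, oM f fM); rewrite -ef leqNgt lt1.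
Qed.

End Kempe.

(** * Translation-invariant polynomials *)

Section Invariants.

Local Open Scope ring_scope.
Variable n : nat.
Local Notation S := {mpoly rat[n]}.
Local Notation V := 'I_n.
Implicit Types (E : seq (V * V)) (i j k : V) (g p q : S) (b : V -> nat).

(** * Induction on polynomials and degree bounds *)

Lemma mnm_neq0_exists (m : 'X_{1..n}) : m != 0%MM -> exists i, m i != 0%N.
Proof.
move=> nz_m; apply/existsP; apply: contraNT nz_m => /existsPn m0.
by apply/eqP/mnmP => i; rewrite mnm0E; have := m0 i; rewrite negbK => /eqP.
Qed.

(** This form of induction suits ring morphisms and derivations, which are determined by their
    values on the variables. *)
Lemma mpoly_var_ind (P : S -> Prop) :
    (forall c, P c%:MP) -> (forall p q, P p -> P q -> P (p + q)) ->
    (forall k p, P p -> P ('X_k * p)) ->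
  forall p, P p.
Proof.
move=> PC PD PX; elim/mpolyind => [|c m p _ _ Pp]; first by rewrite -mpolyC0.
apply: PD => // {p Pp}; have [d] := ubnP (mdeg m).
elim: d m => // d IHd m; have [->|nz_m] := eqVneq m 0%MM.
  by rewrite mpolyX0 alg_mpolyC => _; apply: PC.
have [i nz_mi] := mnm_neq0_exists nz_m.
rewrite -(@submK _ U_(i) m) ?lep1mP // mdegD mdeg1 addn1 ltnS => lt_d.
by rewrite mpolyXD mulrC scalerAr; apply/PX/IHd.
Qed.

(** The bound depends on the variable because identifying two variables adds their bounds and
    dividing by a difference lowers two of them. *)
Definition degree_bound b g :=
  forall m, m \in msupp g -> forall k, (m k <= b k)%N.

Lemma subspace_degree_bound b : is_subspace (degree_bound b).
Proof.
split=> [m|p q bp bq m|c p bp m]; first by rewrite msupp0.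
  by move/msuppD_le; rewrite mem_cat => /orP[/bp|/bq].
by move/msuppZ_le; apply: bp.
Qed.

Lemma subspace_msize d : is_subspace (fun p : S => (msize p <= d)%N).
Proof.
split=> [|p q sp sq|c p sp]; first by rewrite msize0.
  by rewrite (leq_trans (msizeD_le _ _)) // geq_max sp.
exact: leq_trans (msizeZ_le _ _) sp.
Qed.

Lemma mcoeffXUM k p m :
  ('X_k * p)@_m = if m k == 0%N then 0 else p@_(m - U_(k)).
Proof.
case: ifPn => [m0|nz_m].
  apply/eqP; rewrite mulrC mcoeff_eq0 (perm_mem (msuppMX _ _)).
  apply: contraL m0 => /mapP[m' _ ->].
  by rewrite mnmDE mnm1E eqxx.
by rewrite -[in LHS](@submK _ U_(k) m) ?lep1mP // addmC mulrC mcoeffMX.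
Qed.

(** The infinitesimal generator of the translations along [(1, ..., 1)]; over the rationals its
    kernel consists of the translation-invariant polynomials. *)
Definition translation_deriv g : S := \sum_k g^`M(k).

Lemma translation_derivM p q :
  translation_deriv (p * q) = translation_deriv p * q + p * translation_deriv q.
Proof.
rewrite /translation_deriv mulr_suml mulr_sumr -big_split.
by apply: eq_bigr => k _; rewrite mderivM.
Qed.

Lemma translation_derivX i : translation_deriv 'X_i = 1.
Proof.
rewrite /translation_deriv (bigD1 i) //= big1 => [|k nk].
  rewrite mderivX mnm1E eqxx scale1r addr0 -mpolyX0; congr 'X_[_].
  by apply/mnmP => k; rewrite mnmBE mnm0E subnn.
by rewrite mderivX mnm1E eq_sym (negPf nk) scale0r.
Qed.

Lemma subspace_translation_deriv0 : is_subspace (fun g => translation_deriv g = 0).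
Proof.
rewrite /translation_deriv; split=> [|p q Dp Dq|c p Dp].
- by rewrite big1 // => k _; rewrite mderiv0.
- by under eq_bigr do rewrite mderivD; rewrite big_split /= Dp Dq addr0.
- by under eq_bigr do rewrite mderivZ; rewrite -scaler_sumr Dp scaler0.
Qed.

Lemma translation_deriv_diff i j : translation_deriv ('X_i - 'X_j) = 0.
Proof.
rewrite /translation_deriv; under eq_bigr do rewrite mderivB.
by rewrite sumrB -!/(translation_deriv _) !translation_derivX subrr.
Qed.

Lemma translation_deriv_graph_monomial E :
  translation_deriv (graph_monomial E) = 0.
Proof.
elim: E => [|e E IHE].
  rewrite /graph_monomial big_nil /translation_deriv big1 // => k _.
  exact: mderivC.
rewrite graph_monomial_cons translation_derivM translation_deriv_diff IHE.
by rewrite mul0r mulr0 addr0.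
Qed.

Lemma graph_monomial_homog E : graph_monomial E \is (size E).-homog.
Proof.
elim: E => [|e E IHE]; first by rewrite /graph_monomial big_nil dhomog1.
rewrite graph_monomial_cons /= -add1n; apply: dhomogM => //.
by rewrite rpredB // dhomogX /= mdeg1.
Qed.

Lemma dhomog_msize_le d p : p \is d.-homog -> (msize p <= d.+1)%N.
Proof.
move/dhomogP=> hp; rewrite msizeE.
by apply/bigmax_leqP_seq => m /hp ->.
Qed.

Lemma graph_monomial_degree_bound E : degree_bound (vdeg E) (graph_monomial E).
Proof.
elim: E => [|e E IHE] m.
  by rewrite /graph_monomial big_nil msupp1 inE => /eqP-> k; rewrite mnm0E.
rewrite graph_monomial_cons mulrBl => /msuppB_le; rewrite mem_cat => em k.
have [i [m']] : exists i m',
  [/\ m = (U_(i) + m')%MM, m' \in msupp (graph_monomial E) & i \in [:: e.1; e.2]].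
  by case/orP: em; rewrite mulrC (perm_mem (msuppMX _ _)) => /mapP[m' m'E ->];
    [exists e.1, m'|exists e.2, m']; rewrite ?inE ?eqxx ?orbT addmC.
case=> -> /IHE/(_ k) le_m' ie; rewrite vdeg_cons mnmDE mnm1E leq_add //.
by move: ie; rewrite !inE => /orP[]/eqP->; rewrite ?leq_addr ?leq_addl.
Qed.

(** * Identification of variables *)

Definition rename (s : V -> V) : S -> S := comp_mpoly [tuple 'X_(s k) | k < n].

Lemma renameX s k : rename s 'X_k = 'X_(s k).
Proof. by rewrite /rename comp_mpolyXU -tnth_nth tnth_mktuple. Qed.

Lemma renameD s : {morph rename s : p q / p + q}.
Proof. exact: comp_mpolyD. Qed.

Lemma renameB s : {morph rename s : p q / p - q}.
Proof. exact: comp_mpolyB. Qed.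

Lemma renameM s : {morph rename s : p q / p * q}.
Proof. exact: rmorphM. Qed.

Lemma renameC s c : rename s c%:MP = c%:MP.
Proof. exact: comp_mpolyC. Qed.

Lemma rename_graph_monomial s E :
  rename s (graph_monomial E) = graph_monomial [seq (s e.1, s e.2) | e <- E].
Proof.
elim: E => [|e E IHE]; first by rewrite /graph_monomial !big_nil /rename comp_mpoly1.
by rewrite /= !graph_monomial_cons -IHE renameM renameB !renameX.
Qed.

Lemma translation_deriv_rename s p :
  translation_deriv (rename s p) = rename s (translation_deriv p).
Proof.
have TC c : translation_deriv c%:MP = 0.
  by rewrite /translation_deriv big1 // => k _; apply: mderivC.
have TD p1 p2 :
    translation_deriv (p1 + p2) = translation_deriv p1 + translation_deriv p2.
  by rewrite /translation_deriv -big_split; apply: eq_bigr => k _; apply: mderivD.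
elim/mpoly_var_ind: p => [c|p q IHp IHq|k p IHp].
- by rewrite renameC TC -mpolyC0 renameC.
- by rewrite TD !renameD TD IHp IHq.
rewrite translation_derivM translation_derivX mul1r renameD !renameM renameX.
by rewrite translation_derivM translation_derivX IHp mul1r.
Qed.

(** The effect of [rename s] on exponents: those over a fibre of [s] add up. *)
Definition mrename (s : V -> V) (m : 'X_{1..n}) : 'X_{1..n} :=
  (\sum_k U_(s k) *+ m k)%MM.

Lemma mrenameE s m k : mrename s m k = (\sum_(i | s i == k) m i)%N.
Proof.
rewrite /mrename mnm_sumE [RHS]big_mkcond; apply: eq_bigr => i _.
by rewrite mulmnE mnm1E; case: eqP; rewrite ?mul1n.
Qed.

Lemma mdeg_mrename s m : mdeg (mrename s m) = mdeg m.
Proof.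
rewrite /mrename mdeg_sum mdegE.
by apply: eq_bigr => k _; rewrite mdegMn mdeg1 mul1n.
Qed.

Lemma msupp_rename s p m : m \in msupp (rename s p) ->
  exists2 m', m' \in msupp p & m = mrename s m'.
Proof.
rewrite /rename comp_mpolyE => /msupp_sum_le/flattenP[_ /mapP[m' m'p ->]].
rewrite mem_filter /= in m'p.
move/msuppZ_le; under eq_bigr do rewrite tnth_mktuple.
rewrite mprodXnE msuppX inE => /eqP->.
by exists m'.
Qed.

Lemma rename_degree_bound s b p : degree_bound b p ->
  degree_bound (fun k => \sum_(i | s i == k) b i)%N (rename s p).
Proof.
move=> bp _ /msupp_rename[m mp ->] k; rewrite mrenameE.
by apply: leq_sum => i _; apply: bp.
Qed.

Lemma msize_rename s p : (msize (rename s p) <= msize p)%N.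
Proof.
rewrite [leqLHS]msizeE; apply/bigmax_leqP_seq => _ /msupp_rename[m mp ->] _.
by rewrite mdeg_mrename msize_mdeg_lt.
Qed.

(** * Division by a difference of variables *)

Definition merge i j k := if k == i then j else k.

(** The factor theorem for the substitution of [x_j] for [x_i]. *)
Lemma sub_merge_dvd i j p :
  exists q, p - rename (merge i j) p = ('X_i - 'X_j) * q.
Proof.
elim/mpoly_var_ind: p => [c|p q [p' Ep] [q' Eq]|k p [q Eq]].
- by exists 0; rewrite renameC subrr mulr0.
- by exists (p' + q'); rewrite renameD mulrDr -Ep -Eq; ring.
rewrite renameM renameX {1}/merge; case: eqP => [->|_].
  exists ('X_i * q + rename (merge i j) p).
  by rewrite mulrDr mulrCA -Eq; ring.
by exists ('X_k * q); rewrite mulrCA -Eq; ring.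
Qed.

(* If the bound fails at a monomial [m] of the quotient, the coefficient of
   [m * X_i] in the product can only cancel against that of [m * X_i / X_j] in
   the quotient, which violates the bound too and has a smaller exponent of
   [X_j]. *)
Lemma degree_bound_div_diff_one i j b q k m :
    j != i -> j != k -> degree_bound b (('X_i - 'X_j) * q) -> m \in msupp q ->
  (m k + (i == k) <= b k)%N.
Proof.
move=> ne_ji ne_jk bq; have [d] := ubnP (m j).
elim: d m => // d IHd m lt_d mq; rewrite leqNgt; apply/negP => lt_b.
have : (('X_i - 'X_j) * q)@_(m + U_(i)) = 0.
  apply: memN_msupp_eq0; apply/negP => /bq/(_ k).
  by rewrite mnmDE mnm1E leqNgt lt_b.
rewrite mulrBl mcoeffB !mcoeffXUM !mnmDE !mnm1E eqxx addn1 /= addmK.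
rewrite (eq_sym i) (negPf ne_ji) addn0.
case: ifPn => [_|nz_mj]; first by apply/eqP; rewrite subr0 -mcoeff_msupp.
move/eqP; rewrite subr_eq0 => /eqP Em.
set m' := (_ - _)%MM in Em.
have m'E x : m' x = (m x + (i == x) - (j == x))%N.
  by rewrite /m' mnmBE mnmDE !mnm1E.
have m'q : m' \in msupp q by rewrite mcoeff_msupp -Em -mcoeff_msupp.
have lt_m' : (m' j < d)%N.
  rewrite m'E eqxx (eq_sym i) (negPf ne_ji) addn0 subn1.
  by case: (m j) nz_mj lt_d.
have := IHd m' lt_m' m'q; rewrite m'E (negPf ne_jk) subn0 leqNgt => /negP[].
by rewrite (leq_trans lt_b) // leq_addr.
Qed.

(** Every [k] differs from [i] or from [j], so the one-sided estimate applies to [X_i - X_j] or to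
    its negative. *)
Lemma degree_bound_div_diff i j b q :
    i != j -> degree_bound b (('X_i - 'X_j) * q) ->
  degree_bound (fun k => b k - ((i == k) + (j == k)))%N q.
Proof.
move=> ne_ij bq m mq k.
have bq' : degree_bound b (('X_j - 'X_i) * q).
  rewrite -opprB mulNr -scaleN1r.
  by have [_ _] := subspace_degree_bound b; apply.
have [eik|nik] := eqVneq i k.
  have ne_jk : j != k by rewrite -eik eq_sym.
  have := @degree_bound_div_diff_one i j b q k m _ ne_jk bq mq.
  by rewrite eq_sym ne_ij eik eqxx (negPf ne_jk) => /(_ isT); lia.
have := @degree_bound_div_diff_one j i b q k m ne_ij nik bq' mq.
by lia.
Qed.

(** Greedy lifting: each letter takes a vertex of its fibre with capacity left and uses up one unit
    of it. *)
Lemma lift_vertices (s : V -> V) b (w : seq V) :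
    (forall x, count_mem x w <= \sum_(k | s k == x) b k)%N ->
  exists2 w', map s w' = w & forall k, (count_mem k w' <= b k)%N.
Proof.
elim: w b => [|x w IHw] b bw; first by exists [::].
have [k /andP[/eqP sk bk]] : exists k, (s k == x) && (0 < b k)%N.
  apply/existsP; apply: contraT => /existsPn nb.
  have := bw x; rewrite big1 /= ?eqxx // => k sk; have := nb k.
  by rewrite sk /= -eqn0Ngt => /eqP.
have [y|w' Ew cw'] := IHw (fun k' => b k' - (k == k'))%N.
  have [exy|nxy] := eqVneq y x; last first.
    apply: leq_trans (leq_trans (bw y) _); first by rewrite leq_addl.
    apply: leq_sum => k' /eqP sk'; have [ek|] := eqVneq k k'; last by rewrite subn0.
    by rewrite -sk' -ek sk eqxx in nxy.
  have := bw y; rewrite exy /= eqxx (bigD1 k) ?sk //=.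
  rewrite [X in _ -> (_ <= X)%N](bigD1 k) ?sk //= eqxx subn1 => le_c.
  rewrite -ltnS; apply: leq_trans le_c _; rewrite -addSn prednK // leq_add2l.
  apply/eq_leq/eq_bigr => k' /andP[_ nk].
  by rewrite eq_sym (negPf nk) subn0.
exists (k :: w'); first by rewrite /= sk Ew.
move=> k' /=; have := cw' k'; have [<-|] := eqVneq k k'; last by rewrite subn0.
by rewrite add1n subn1; case: (b k) bk.
Qed.

(** Degrees count occurrences in the list of all edge ends, so this list is lifted as one word and
    then cut in half. *)
Lemma lift_graph (s : V -> V) b E :
    (forall x, vdeg E x <= \sum_(k | s k == x) b k)%N ->
  exists E', [/\ size E' = size E, [seq (s e.1, s e.2) | e <- E'] = E
                & forall k, (vdeg E' k <= b k)%N].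
Proof.
move=> bE; have [|w' Ew cw'] := @lift_vertices s b (unzip1 E ++ unzip2 E).
  by move=> x; rewrite count_cat; apply: bE.
have sz_w : size w' = (size E + size E)%N.
  by rewrite -(size_map s) Ew size_cat !size_map.
have sz1 : size (take (size E) w') = size E by rewrite size_takel // sz_w leq_addr.
have sz2 : size (drop (size E) w') = size E by rewrite size_drop sz_w addnK.
have u1 : unzip1 (zip (take (size E) w') (drop (size E) w')) = take (size E) w'.
  by rewrite unzip1_zip // sz1 sz2.
have u2 : unzip2 (zip (take (size E) w') (drop (size E) w')) = drop (size E) w'.
  by rewrite unzip2_zip // sz1 sz2.
exists (zip (take (size E) w') (drop (size E) w')); split.
- by rewrite size_zip sz1 sz2 minnn.
- set Z := zip _ _ in u1 u2 *.
  rewrite -[RHS]zip_unzip -[LHS]zip_unzip; congr zip.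
    have -> : unzip1 [seq (s e.1, s e.2) | e <- Z] = map s (unzip1 Z).
      by rewrite /unzip1 -!map_comp.
    by rewrite u1 map_take Ew take_size_cat // size_map.
  have -> : unzip2 [seq (s e.1, s e.2) | e <- Z] = map s (unzip2 Z).
    by rewrite /unzip2 -!map_comp.
  by rewrite u2 map_drop Ew drop_size_cat // size_map.
- by move=> k; rewrite /vdeg u1 u2 -count_cat cat_take_drop.
Qed.

(** * The span of graph monomials *)

Definition graph_span b (d : nat) : S -> Prop :=
  lspan (fun g => exists E,
    [/\ (size E <= d)%N, forall k, (vdeg E k <= b k)%N & g = graph_monomial E]).

Lemma graph_span_props b d g : graph_span b d g ->
  [/\ degree_bound b g, translation_deriv g = 0 & (msize g <= d.+1)%N].
Proof.
move=> sg; split.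
- apply: (sg (degree_bound b)); first exact: subspace_degree_bound.
  move=> _ [E [_ bE ->]] m /graph_monomial_degree_bound mE k.
  exact: leq_trans (bE k).
- apply: (sg (fun p => translation_deriv p = 0)).
    exact: subspace_translation_deriv0.
  by move=> _ [E [_ _ ->]]; apply: translation_deriv_graph_monomial.
apply: (sg (fun p => (msize p <= d.+1)%N)); first exact: subspace_msize.
move=> _ [E [sE _ ->]].
apply: leq_trans (dhomog_msize_le (graph_monomial_homog E)) _.
by rewrite ltnS.
Qed.

(** At most one variable [x_i] can occur, so only its partial derivative contributes, and in
    characteristic zero this kills constants only. *)
Lemma invariant_one_variable b g :
    degree_bound b g -> translation_deriv g = 0 ->
    (forall i j, (0 < b i)%N -> (0 < b j)%N -> i = j) ->
  g = (g@_0)%:MP.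
Proof.
move=> bg Dg b1; apply: msize1_polyC; rewrite msizeE.
apply/bigmax_leqP_seq => m mg _; rewrite ltnS leqn0 mdeg_eq0.
apply: contraT => nz_m.
have [i nz_mi] := mnm_neq0_exists nz_m.
have := congr1 (mcoeff (m - U_(i))%MM) Dg; rewrite mcoeff0 /translation_deriv.
rewrite raddf_sum (bigD1 i) //= big1 => [|k ne_ki].
  rewrite mcoeff_deriv submK ?lep1mP // addr0 => /eqP.
  by rewrite mulrn_eq0 /= => /eqP gm0; rewrite mcoeff_msupp gm0 eqxx in mg.
rewrite mcoeff_deriv memN_msupp_eq0 ?mul0rn //.
apply/negP => /bg/(_ k); rewrite mnmDE mnm1E eqxx addn1 => bk.
have bi : (0 < b i)%N by apply: leq_trans (bg m mg i); rewrite lt0n.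
by rewrite (b1 k i (leq_ltn_trans (leq0n _) bk) bi) eqxx in ne_ki.
Qed.

(* Induction on the degree and on the number of variables: identify [x_i] with
   [x_j], lift a combination of graph monomials that represents the result, and
   divide the difference by [x_i - x_j]. *)
Theorem invariant_graph_span b d g :
    (msize g <= d.+1)%N -> degree_bound b g -> translation_deriv g = 0 ->
  graph_span b d g.
Proof.
(* The measure drops in both recursive calls: identification removes a variable with positive bound,
   division lowers the degree. *)
have [N] := ubnP (d + #|[pred k | 0 < b k]|)%N.
elim: N b d g => // N IHN b d g ltN sg bg Dg.
have [/existsP[i /existsP[j /and3P[ne_ij bi bj]]]|/existsPn nb] :=
    boolP [exists i, exists j, [&& i != j, 0 < b i & 0 < b j]%N]; last first.
  rewrite (invariant_one_variable bg Dg); last first.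
    move=> i j bi bj; apply/eqP; have /existsPn/(_ j) := nb i.
    by rewrite bi bj !andbT negbK.
  have [_ _ WZ] : is_subspace (graph_span b d) by apply: lspan_subspace.
  rewrite -alg_mpolyC; apply: WZ; apply: mem_lspan; exists [::]; split=> //.
  by rewrite /graph_monomial big_nil.
pose s := merge i j; pose b' k := (\sum_(k' | s k' == k) b k')%N.
have ltb' : (#|[pred k | 0 < b' k]| < #|[pred k | 0 < b k]|)%N.
  apply: proper_card; apply/properP; split; last first.
    exists i; rewrite ?inE //; rewrite -eqn0Ngt /b' big_pred0 // => k.
    rewrite /s /merge; case: (eqVneq k i) => [_|/negPf//].
    by rewrite eq_sym (negPf ne_ij).
  apply/subsetP => k; rewrite !inE; have [->//|ne_kj] := eqVneq k j.
  rewrite /b' lt0n sum_nat_eq0 negb_forall => /existsP[k'].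
  rewrite negb_imply /s /merge -lt0n => /andP[/eqP <-].
  by case: (eqVneq k' i) ne_kj => // ->; rewrite eqxx => /negP[].
have : graph_span b' d (rename s g).
  apply: IHN; last by rewrite translation_deriv_rename Dg -mpolyC0 renameC.
  - by rewrite -ltnS (leq_trans _ ltN) // ltnS ltn_add2l.
  - exact: leq_trans (msize_rename _ _) sg.
  - exact: rename_degree_bound.
(* Each graph of the merged span lifts along [s], hence so does the whole combination. *)
move=> /(_ (fun p => exists2 g', graph_span b d g' & rename s g' = p)) [].
- have [G0 GD GZ] : is_subspace (graph_span b d) by apply: lspan_subspace.
  split=> [|p q [p' sp <-] [q' sq <-]|c p [p' sp <-]].
  + by exists 0; rewrite // -mpolyC0 renameC.
  + by exists (p' + q'); rewrite ?renameD //; apply: GD.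
  + by exists (c *: p'); rewrite /rename ?comp_mpolyZ //; apply: GZ.
- move=> _ [E [sE bE ->]]; have [E' [sE' EE' bE']] := lift_graph bE.
  exists (graph_monomial E'); last by rewrite rename_graph_monomial EE'.
  by apply: mem_lspan; exists E'; rewrite sE'.
move=> g' sg' eq_ren.
have [q Eq] := sub_merge_dvd i j (g - g').
rewrite -/s renameB eq_ren subrr subr0 in Eq.
have Eg : g = g' + ('X_i - 'X_j) * q by rewrite -Eq addrC subrK.
have [bg' Dg' mg'] := graph_span_props sg'.
have [G0 GD GZ] : is_subspace (graph_span b d) by apply: lspan_subspace.
rewrite Eg; apply: (GD) => //.
have [->|nz_q] := eqVneq q 0; first by rewrite mulr0.
have nz_ij : ('X_i - 'X_j : S) != 0.
  rewrite subr_eq0; apply: contra ne_ij => /eqP/(congr1 (mcoeff U_(i))).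
  by rewrite !mcoeffXU eqxx eq_sym; case: eqP => // _ /eqP; rewrite oner_eq0.
have szq : (msize q < d.+1)%N.
  have : (msize (g - g') <= d.+1)%N by apply: (subspaceB (subspace_msize _)).
  rewrite Eq msizeM //; apply: leq_trans.
  have : U_(i)%MM \in msupp ('X_i - 'X_j : S).
    rewrite mcoeff_msupp mcoeffB !mcoeffXU eqxx (eq_sym j) (negPf ne_ij).
    by rewrite subr0 oner_eq0.
  move/msize_mdeg_lt; rewrite mdeg1; case: (msize (_ - _)) => // -[] // c _.
  by rewrite !addSn ltnS leq_addl.
have d_gt0 : (0 < d)%N.
  rewrite lt0n; apply: contra nz_q => /eqP d0; rewrite -msize_poly_eq0.
  by move: szq; rewrite d0 ltnS leqn0.
have : graph_span (fun k => b k - ((i == k) + (j == k)))%N d.-1 q.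
  apply: IHN.
  - rewrite -ltnS (leq_trans _ ltN) // ltnS -[in leqRHS](prednK d_gt0) addSn.
    rewrite ltnS leq_add2l.
    apply: subset_leq_card; apply/subsetP => k; rewrite !inE => lt_k.
    by apply: leq_trans lt_k (leq_subr _ _).
  - by rewrite prednK.
  - apply: degree_bound_div_diff => //; rewrite -Eq.
    by apply: (subspaceB (subspace_degree_bound _)).
  - have : translation_deriv (g - g') = 0.
      exact: (subspaceB subspace_translation_deriv0).
    rewrite Eq translation_derivM translation_deriv_diff mul0r add0r => /eqP.
    by rewrite mulf_eq0 (negPf nz_ij) => /eqP.
move=> /(_ (fun p => graph_span b d (('X_i - 'X_j) * p))); apply.
  split=> [|p p' sp sp'|c p sp].
  - by rewrite mulr0.
  - by rewrite mulrDr; apply: GD.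
  - by rewrite -scalerAr; apply: GZ.
(* The extra edge restores the bounds [b]: as [b i] and [b j] are positive, the truncated
   subtractions are exact. *)
move=> _ [E [sE bE ->]]; apply: mem_lspan; exists ((i, j) :: E).
rewrite graph_monomial_cons; split=> // [|k].
  by rewrite /= -(prednK d_gt0) ltnS.
rewrite vdeg_cons /=; have := bE k; have [<-|_] := eqVneq i k.
  by rewrite (eq_sym j) (negPf ne_ij) addn0 => ?; rewrite -(subnKC bi) leq_add2l.
have [<-|_] := eqVneq j k; last by rewrite subn0.
by move=> ?; rewrite -(subnKC bj) leq_add2l.
Qed.

End Invariants.

(** * Leading forms and finite differences *)

Section LeadingForms.

Local Open Scope ring_scope.
Variable n : nat.
Local Notation S := {mpoly rat[n]}.
Local Notation V := 'I_n.
Implicit Types (E : seq (V * V)) (i j k : V) (f g F G p q : S) (m : 'X_{1..n}).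

Lemma msize_leP p d :
  reflect (forall m, m \in msupp p -> (mdeg m < d)%N) (msize p <= d)%N.
Proof.
rewrite msizeE; apply: (iffP (bigmax_leqP_seq _ _ _ _)) => H m mp.
  exact: H.
by move=> _; apply: H.
Qed.

(* [F] may be zero, in which case [f] has degree less than [d]. *)
Definition leading_form (d : nat) f F := F \is d.-homog /\ (msize (f - F) <= d)%N.

Lemma leading_form_msize d f F : leading_form d f F -> (msize f <= d.+1)%N.
Proof.
case=> hF sf; rewrite -[f](subrK F) (leq_trans (msizeD_le _ _)) // geq_max.
by rewrite leqW //= dhomog_msize_le.
Qed.

Lemma leading_formX m : leading_form (mdeg m) 'X_[m] 'X_[m].
Proof. by split; rewrite ?dhomogX ?subrr ?msize0 //=. Qed.

Lemma leading_formB d f1 f2 F1 F2 :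
  leading_form d f1 F1 -> leading_form d f2 F2 -> leading_form d (f1 - f2) (F1 - F2).
Proof.
move=> [h1 s1] [h2 s2]; split; first by rewrite rpredB.
have -> : f1 - f2 - (F1 - F2) = (f1 - F1) - (f2 - F2) by ring.
exact: (subspaceB (subspace_msize _ _)).
Qed.

(** [msize] is the degree plus one: a factor of degree below [a] and one of degree at most [b] give
    a product of degree below [a + b]. *)
Lemma msizeM_bound p q a b :
  (msize p <= a)%N -> (msize q <= b.+1)%N -> (msize (p * q) <= a + b)%N.
Proof.
move=> sp sq; have [->|nz_p] := eqVneq p 0; first by rewrite mul0r msize0.
have [->|nz_q] := eqVneq q 0; first by rewrite mulr0 msize0.
by rewrite msizeM // -subn1 leq_subLR add1n -addnS leq_add.
Qed.

Lemma leading_formM d1 d2 f1 f2 F1 F2 :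
    leading_form d1 f1 F1 -> leading_form d2 f2 F2 ->
  leading_form (d1 + d2) (f1 * f2) (F1 * F2).
Proof.
move=> l1 l2; have [[h1 s1] [h2 s2]] := (l1, l2).
split; first exact: dhomogM.
have -> : f1 * f2 - F1 * F2 = (f1 - F1) * f2 + (f2 - F2) * F1 by ring.
have [_ WD _] := @subspace_msize n (d1 + d2); apply: WD.
  exact: msizeM_bound s1 (leading_form_msize l2).
by rewrite addnC; apply: msizeM_bound s2 (dhomog_msize_le h1).
Qed.

Lemma leading_form_prod (I : Type) (r : seq I) (d : I -> nat) (f F : I -> S) :
    (forall x, leading_form (d x) (f x) (F x)) ->
  leading_form (\sum_(x <- r) d x) (\prod_(x <- r) f x) (\prod_(x <- r) F x).
Proof.
move=> lf; elim: r => [|i r IHr]; last by rewrite !big_cons; apply: leading_formM.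
by rewrite !big_nil -mpolyX0 -[X in leading_form X](@mdeg0 n); apply: leading_formX.
Qed.

Lemma mcoeff_pihomog d p m :
  (pihomog (@mdeg n) d p)@_m = if mdeg m == d then p@_m else 0.
Proof.
elim/mpolyind: p => [|c m' p _ _ IHp].
  by rewrite pihomog0 mcoeff0 if_same.
rewrite pihomogD linearZ /= pihomogX !mcoeffD !mcoeffZ IHp mcoeffX.
have [<-|nm] := eqVneq m' m.
  by case: ifP; rewrite ?mcoeffX ?eqxx ?mcoeff0 ?mulr0 ?add0r.
have -> : (if mdeg m' == d then 'X_[m'] else 0 : S)@_m = 0.
  by case: ifP; rewrite ?mcoeff0 // mcoeffX (negPf nm).
by rewrite mulr0 !add0r.
Qed.

Lemma top_component_leading_form f :
  f != 0 -> leading_form (msize f).-1 f (top_component f).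
Proof.
move=> nz_f; split; first exact: pihomogP.
apply/msize_leP => m; rewrite mcoeff_msupp mcoeffB mcoeff_pihomog.
case: (eqVneq (mdeg m)) => [_|ne]; first by rewrite subrr eqxx.
rewrite subr0 -mcoeff_msupp => /msize_mdeg_lt.
by rewrite (mpolySpred _ nz_f) ltnS leq_eqVlt (negPf ne).
Qed.

(** Passes from [leading_form], which tolerates cancellation in sums, back to the top component. *)
Lemma leading_form_top d f F :
  F != 0 -> leading_form d f F -> f != 0 /\ top_component f = F.
Proof.
move=> nz_F lf; have [hF sf] := lf.
have r0 m : mdeg m = d -> f@_m = F@_m.
  move=> dm; apply/eqP; rewrite -subr_eq0 -mcoeffB mcoeff_eq0.
  by apply: msize_mdeg_ge; rewrite dm.
have mF := mlead_supp nz_F; have dF := dhomog_mf hF mF.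
have mf : mlead F \in msupp f by rewrite mcoeff_msupp r0 // -mcoeff_msupp.
have nz_f : f != 0 by apply: contraL mf => /eqP->; rewrite msupp0.
split=> //; rewrite /top_component.
have -> : msize f = d.+1.
  apply/eqP; rewrite eqn_leq (leading_form_msize lf) -dF.
  exact: msize_mdeg_lt.
apply/mpolyP => m; rewrite mcoeff_pihomog /=; case: eqP => [/r0//|/eqP dm].
by rewrite (dhomog_nemf_coeff hF dm).
Qed.

(** * The differentiation pairing *)

Lemma big_msupp_widen (W : nmodType) (phi : 'X_{1..n} -> rat -> W)
    (r : seq 'X_{1..n}) p :
    (forall m, phi m 0 = 0) -> uniq r -> {subset msupp p <= r} ->
  \sum_(m <- msupp p) phi m p@_m = \sum_(m <- r) phi m p@_m.
Proof.
move=> phi0 ur sr; rewrite [RHS](bigID (mem (msupp p))) /=.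
rewrite [X in _ + X]big1 => [|m /memN_msupp_eq0->]; last exact: phi0.
rewrite addr0 -[RHS]big_filter; apply: perm_big; apply: uniq_perm.
- exact: msupp_uniq.
- exact: filter_uniq.
by move=> m; rewrite mem_filter; case: (boolP (m \in _)) => // /sr.
Qed.

Definition mfact m := (\prod_i (m i)`!)%N.

Lemma mfact_gt0 m : (0 < mfact m)%N.
Proof. by apply: prodn_gt0 => i; rewrite fact_gt0. Qed.

(** The apolar pairing, that is, the constant term of [diff_action F G]. *)
Definition pairing F G : rat := \sum_(m <- msupp F) F@_m * G@_m * (mfact m)%:R.

Lemma pairingDl F1 F2 G : pairing (F1 + F2) G = pairing F1 G + pairing F2 G.
Proof.
(* A common list of exponents makes the sums over three different supports comparable. *)
pose r := undup (msupp F1 ++ msupp F2 ++ msupp (F1 + F2)).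
have E F : {subset msupp F <= r} ->
    pairing F G = \sum_(m <- r) F@_m * G@_m * (mfact m)%:R.
  apply: (@big_msupp_widen _ (fun m c => c * G@_m * (mfact m)%:R)) => [m|].
    by rewrite !mul0r.
  exact: undup_uniq.
rewrite !E ?/r -?big_split /=; first last.
- by move=> m mF; rewrite mem_undup !mem_cat mF ?orbT.
- by move=> m mF; rewrite mem_undup !mem_cat mF ?orbT.
- by move=> m mF; rewrite mem_undup !mem_cat mF ?orbT.
by apply: eq_bigr => m _; rewrite mcoeffD !mulrDl.
Qed.

Lemma pairingZl c F G : pairing (c *: F) G = c * pairing F G.
Proof.
have E : pairing (c *: F) G = \sum_(m <- msupp F) (c *: F)@_m * G@_m * (mfact m)%:R.
  apply: (@big_msupp_widen _ (fun m c => c * G@_m * (mfact m)%:R)) => [m||].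
  - by rewrite !mul0r.
  - exact: msupp_uniq.
  - exact: msuppZ_le.
rewrite E /pairing mulr_sumr.
by apply: eq_bigr => m _; rewrite mcoeffZ !mulrA.
Qed.

Lemma pairing0l G : pairing 0 G = 0.
Proof. by rewrite /pairing msupp0 big_nil. Qed.

Lemma pairingBl F1 F2 G : pairing (F1 - F2) G = pairing F1 G - pairing F2 G.
Proof. by rewrite pairingDl -scaleN1r pairingZl mulN1r. Qed.

Lemma pairingBr F G1 G2 : pairing F (G1 - G2) = pairing F G1 - pairing F G2.
Proof.
rewrite /pairing -sumrB; apply: eq_bigr => m _.
by rewrite mcoeffB mulrBr mulrBl.
Qed.

Lemma pairingX m G : pairing 'X_[m] G = G@_m * (mfact m)%:R.
Proof. by rewrite /pairing msuppX big_seq1 mcoeffX eqxx mul1r. Qed.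

Lemma pairing_homog_neq d e F G :
  F \is d.-homog -> G \is e.-homog -> d != e -> pairing F G = 0.
Proof.
move=> hF hG ne; rewrite /pairing big1_seq // => m /andP[_ /(dhomog_mf hF) dm].
by rewrite (dhomog_nemf_coeff hG) ?mulr0 ?mul0r //= dm.
Qed.

Lemma mfact_subU m k : m k != 0%N -> mfact m = (m k * mfact (m - U_(k)))%N.
Proof.
move=> nz; rewrite /mfact (bigD1 k) //= [in RHS](bigD1 k) //= mulnA.
rewrite mnmBE mnm1E eqxx subn1; congr (_ * _)%N.
  by case: (m k) nz => // c _; rewrite factS.
by apply: eq_bigr => i ne; rewrite mnmBE mnm1E eq_sym (negPf ne) subn0.
Qed.

(** Multiplication by a variable is adjoint to differentiation, so the edges of a graph monomial can
    be moved one by one to the other argument. *)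
Lemma pairing_varM F k G : pairing F ('X_k * G) = pairing F^`M(k) G.
Proof.
elim/mpolyind: F => [|c m F _ _ IHF]; first by rewrite mderiv0 !pairing0l.
rewrite mderivD mderivZ !pairingDl !pairingZl IHF mderivX pairingZl !pairingX.
congr (_ * _ + _); rewrite mcoeffXUM.
case: ifPn => [/eqP->|nz]; first by rewrite !mul0r.
by rewrite (mfact_subU nz) natrM mulrCA.
Qed.

(** * Shifts and finite differences *)

Definition shift k : S -> S :=
  comp_mpoly [tuple 'X_i + (i == k)%:R%:MP_[n] | i < n].

Lemma shiftC k c : shift k c%:MP = c%:MP.
Proof. exact: comp_mpolyC. Qed.

Lemma shiftXM k i p : shift k ('X_i * p) = ('X_i + (i == k)%:R%:MP) * shift k p.
Proof. by rewrite /shift rmorphM /= comp_mpolyXU -tnth_nth tnth_mktuple. Qed.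

Lemma meval_shift k p (v : V -> rat) :
  (shift k p).@[v] = p.@[fun i => v i + (i == k)%:R].
Proof.
rewrite /shift comp_mpoly_meval; apply: meval_eq => i.
by rewrite tnth_mktuple mevalD mevalXU mevalC.
Qed.

Lemma msize_mderiv k p : (msize p^`M(k) <= (msize p).-1)%N.
Proof.
apply/msize_leP => m; rewrite mcoeff_msupp mcoeff_deriv mulrn_eq0 /=.
rewrite -mcoeff_msupp => /msize_mdeg_lt; rewrite mdegD mdeg1 addn1.
by case: (msize p).
Qed.

Lemma msizeXM i p d : (msize p <= d.-1)%N -> (msize ('X_i * p) <= d)%N.
Proof.
have [->|nz_p] := eqVneq p 0; first by rewrite mulr0 msize0.
case: d => [|d] /= sp; first by move: sp; rewrite leqn0 msize_poly_eq0 (negPf nz_p).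
rewrite -add1n addnC mulrC; apply: msizeM_bound => //.
by rewrite msizeX mdeg1.
Qed.

(** The Taylor remainder after the linear term loses two degrees. *)
Lemma msize_shift_remainder k p :
  (msize (shift k p - p - p^`M(k)) <= (msize p).-2)%N.
Proof.
pose r q : S := shift k q - q - q^`M(k).
have rD q1 q2 : r (q1 + q2) = r q1 + r q2.
  by rewrite /r /shift comp_mpolyD mderivD; ring.
have rZ c q : r (c *: q) = c *: r q.
  by rewrite /r /shift comp_mpolyZ mderivZ !scalerBr.
(* The product rule for the remainder drives the induction on monomials. *)
have rXM i q : r ('X_i * q) = 'X_i * r q + (i == k)%:R *: (q^`M(k) + r q).
  rewrite /r shiftXM mderivM [('X_i)^`M(k)]mderivX mnm1E.
  have -> : ((i == k)%:R *: 'X_[U_(i) - U_(k)] : S) = (i == k)%:R%:MP.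
    case: eqP => [->|_]; rewrite ?scale0r ?mpolyC0 // scale1r mpolyC1 -mpolyX0.
    by congr 'X_[_]; apply/mnmP => x; rewrite mnmBE mnm0E subnn.
  by rewrite -mul_mpolyC; move: (_%:MP) => c; ring.
have rX m : (msize (r 'X_[m]) <= (mdeg m).-1)%N.
  have [d] := ubnP (mdeg m); elim: d m => // d IHd m.
  have [->|nz_m] := eqVneq m 0%MM.
    by rewrite mpolyX0 -mpolyC1 /r shiftC mderivC subrr subr0 msize0.
  have [i nz_mi] := mnm_neq0_exists nz_m.
  rewrite -(@submK _ U_(i) m) ?lep1mP //; set m' := (m - U_(i))%MM.
  rewrite mdegD mdeg1 addn1 ltnS => lt_d; have /= IHm := IHd _ lt_d.
  set X := 'X_[m'] in IHm *.
  rewrite mpolyXD mulrC rXM.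
  have [_ WD WZ] := @subspace_msize n (mdeg m').
  apply: (WD); first exact: msizeXM.
  apply: WZ; apply: WD; last exact: leq_trans IHm (leq_pred _).
  by apply: leq_trans (msize_mderiv _ _) _; rewrite msizeX.
have r_sum : r p = \sum_(m <- msupp p) p@_m *: r 'X_[m].
  rewrite {1}[p]mpolyE; elim: (msupp p) => [|m s IHs].
    by rewrite !big_nil /r /shift comp_mpoly0 mderiv0 !subr0.
  by rewrite !big_cons rD rZ IHs.
rewrite -/(r p) r_sum big_seq.
apply: (subspace_sum _ (subspace_msize _ _)) => m /msize_mdeg_lt lt_m.
have [_ _ WZ] := @subspace_msize n (msize p).-2; apply: WZ.
apply: leq_trans (rX m) _.
by case: (msize p) lt_m => // c; rewrite ltnS; case: (mdeg m) c => [|x] [].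
Qed.

(** On leading forms a unit difference acts as the derivative; the Taylor remainder only affects
    lower degrees. *)
Lemma leading_form_shift d f F k :
  leading_form d.+1 f F -> leading_form d (shift k f - f) F^`M(k).
Proof.
move=> lf; have [hF sf] := lf; split.
  apply/dhomogP => m; rewrite mcoeff_msupp mcoeff_deriv mulrn_eq0 /=.
  rewrite -mcoeff_msupp => /(dhomog_mf hF) /=; rewrite mdegD mdeg1 addn1.
  by case.
have -> : shift k f - f - F^`M(k) = (shift k f - f - f^`M(k)) + (f - F)^`M(k).
  by rewrite mderivB; ring.
have [_ WD _] := @subspace_msize n d; apply: WD.
  apply: leq_trans (msize_shift_remainder _ _) _.
  by have := leading_form_msize lf; case: (msize f) => [|[]].
by apply: leq_trans (msize_mderiv _ _) _; case: (msize (f - F)) sf.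
Qed.

(* The iterated difference operator attached to [E] is constant on polynomials
   of degree at most [size E], and there it agrees with the differential
   operator attached to [graph_monomial E]. *)
Lemma pairing_leading_form_graph E f F (u : V -> rat) :
    leading_form (size E) f F ->
    (forall w, all2 (fun v e => v \in [:: e.1; e.2]) w E ->
       f.@[fun i => u i + (count_mem i w)%:R] = 0) ->
  pairing F (graph_monomial E) = 0.
Proof.
elim: E f F => [|e E IHE] f F.
  case=> hF; rewrite leqn0 msize_poly_eq0 subr_eq0 => /eqP-> /(_ [::] isT).
  have -> : F = (F@_0)%:MP.
    by apply: msize1_polyC; apply: dhomog_msize_le.
  by rewrite mevalC => ->; rewrite mpolyC0 pairing0l.
move=> /= lf fw.
rewrite graph_monomial_cons mulrBl pairingBr !pairing_varM -pairingBl.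
apply: (IHE (shift e.1 f - shift e.2 f)).
  (* Writing [T_i - T_j] as [(T_i - 1) - (T_j - 1)] exhibits the drop in degree. *)
  have -> : shift e.1 f - shift e.2 f = (shift e.1 f - f) - (shift e.2 f - f).
    by ring.
  by apply: leading_formB; apply: leading_form_shift.
move=> w wE; rewrite mevalB !meval_shift.
(* A term of the expanded operator picks one end [v] of [e] and continues with the picks [w]. *)
have fv v : v \in [:: e.1; e.2] ->
    f.@[fun i => u i + (count_mem i w)%:R + (i == v)%:R] = 0.
  move=> ve; rewrite -[RHS](fw (v :: w)) /= ?ve ?wE //.
  apply: meval_eq => i.
  by rewrite natrD [in RHS](addrC (v == i)%:R) addrA [v == i]eq_sym.
by rewrite !fv ?subrr // !inE eqxx ?orbT.
Qed.

End LeadingForms.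

(** * Harmonic spaces of dilated hypersimplices *)

Section HarmonicSpace.

Local Open Scope ring_scope.
Variables (R : realType) (n l : nat).
Hypothesis le_ln : (l <= n)%N.
Local Notation S := {mpoly rat[n]}.
Local Notation V := 'I_n.
Local Notation P := (@hypersimplex n R l).
Local Notation h := (minn l (n - l)).
Implicit Types (E : seq (V * V)) (i j k : V) (f g F G p q : S) (m : 'X_{1..n}).

(** By adjointness, [diff_action F G] vanishes exactly when [G] is orthogonal to all monomial
    multiples of [F]. *)
Lemma mcoeff_diff_action F G a :
  (diff_action F G)@_a * (mfact a)%:R = pairing ('X_[a] * F) G.
Proof.
rewrite /diff_action raddf_sum /= mulr_suml mulrC /pairing.
rewrite (perm_big _ (msuppMX F a)) /= big_map; apply: eq_bigr => m _.
rewrite mcoeffMX mcoeffZ mcoeff_mderivm -!mulrA addmC; congr (_ * _).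
rewrite -[G@_(_) *+ _]mulr_natr -mulrA -natrM; congr (_ * _%:R).
rewrite /mfact -big_split; apply: eq_bigr => i _.
by have := ffact_fact (leq_addl (a i) (m i)); rewrite addnK mnmDE.
Qed.

Lemma diff_action_eq0 F G :
  (forall a, pairing ('X_[a] * F) G = 0) -> diff_action F G = 0.
Proof.
move=> FG0; apply/mpolyP => a; rewrite mcoeff0; apply/eqP.
have := FG0 a; rewrite -mcoeff_diff_action => /eqP; rewrite mulf_eq0 => /orP[//|].
by rewrite pnatr_eq0 -leqn0 leqNgt mfact_gt0.
Qed.

Lemma perp_subspace (I : S -> Prop) : is_subspace (perp I).
Proof.
split=> [F _|p q Ip Iq F IF|c p Ip F IF]; rewrite /diff_action.
- by rewrite big1 // => m _; rewrite linear0 scaler0.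
- under eq_bigr do rewrite mderivmD scalerDr.
  by rewrite big_split -!/(diff_action _ _) /= Ip ?Iq ?addr0.
- under eq_bigr do rewrite mderivmZ scalerA mulrC -scalerA.
  by rewrite -scaler_sumr -!/(diff_action _ _) Ip ?scaler0.
Qed.

(** * Lattice points and constraints on harmonic polynomials *)

Lemma lattice_dilate_hypersimplexP (d : nat) (z : 'rV[int]_n) :
  lattice_points (dilate d P) z <->
  (forall i, 0 <= z 0 i <= d%:Z) /\ \sum_i z 0 i = (d * l)%N%:Z.
Proof.
split=> [[p [p01 sp] zp]|[z01 sz]].
  have zE i : (z 0 i)%:~R = d%:R * p 0 i by have /rowP/(_ i) := zp; rewrite !mxE.
  split=> [i|].
    have /andP[p0 p1] := p01 i.
    rewrite -!(ler_int R) zE mulr_ge0 //= -[leRHS]mulr1.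
    by rewrite ler_wpM2l.
  apply/eqP; rewrite -(eqr_int R) rmorph_sum /=; under eq_bigr do rewrite zE.
  by rewrite -mulr_sumr sp -natrM.
have [d0|d_gt0] := posnP d.
  (* The zeroth dilate is the origin only if the hypersimplex has a point; the vertex with ones in
     the first [l] places is one. *)
  exists (\row_i (i < l)%:R).
    split=> [i|]; first by rewrite mxE ler0n lern1 leq_b1.
    under eq_bigr do rewrite mxE.
    rewrite -natr_sum -(big_mkcond (fun i : V => (i < l)%N) (fun _ => 1%N)) /=.
    by rewrite (big_ord_narrow le_ln) sum1_card card_ord.
  apply/rowP => i; rewrite !mxE d0 mul0r.
  by have := z01 i; rewrite d0 -eq_le => /eqP <-.
have d_neq0 : d%:R != 0 :> R by rewrite pnatr_eq0 -lt0n.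
exists (d%:R^-1 *: map_mx intr z); last by rewrite scalerA mulfV // scale1r.
split=> [i|].
  have /andP[z0 z1] := z01 i.
  rewrite !mxE mulr_ge0 ?invr_ge0 ?ler0n ?ler0z //=.
  by rewrite mulrC ler_pdivrMr ?ltr0n // mul1r -[leRHS]/(d%:Z%:~R) ler_int.
under eq_bigr do rewrite !mxE.
by rewrite -mulr_sumr -rmorph_sum /= sz PoszM intrM mulKf.
Qed.

(** The monomial is the top component of the product of the linear factors [X_i - c i j], and at
    each point of [Z] one of these factors vanishes. *)
Lemma gr_ideal_monomial (Z : 'rV[int]_n -> Prop) m (c : V -> nat -> rat) :
    (forall z, Z z -> exists i (j : 'I_(m i)), (z 0 i)%:~R = c i j) ->
  gr_ideal Z 'X_[m].
Proof.
move=> cZ J _; apply.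
pose f : S := \prod_i \prod_(j < m i) ('X_i - (c i j)%:MP).
have lf : leading_form (\sum_i \sum_(j < m i) 1) f (\prod_i \prod_(j < m i) 'X_i).
  apply: leading_form_prod => i; apply: leading_form_prod => j; split.
    by rewrite dhomogX /= mdeg1.
  by rewrite addrAC subrr sub0r msizeN msizeC; case: (_ != _).
have EX : 'X_[m] = \prod_i \prod_(j < m i) 'X_i :> S.
  by rewrite mpolyXE_id; apply: eq_bigr => i _; rewrite prodr_const card_ord.
have [|nz_f top_f] := leading_form_top _ lf.
  by rewrite -EX -msize_poly_eq0 msizeX.
exists f; split=> // [z /cZ[i [j zij]]|]; last by rewrite EX top_f.
rewrite /f rmorph_prod (bigD1 i) //= rmorph_prod (bigD1 j) //=.
by rewrite mevalB mevalXU mevalC zij subrr !mul0r.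
Qed.

(** The constant term of the action of [X^m] on [g] is [g@_m] times the factorial of [m]. *)
Lemma mcoeff_perp_monomial (I : S -> Prop) m g :
  I 'X_[m] -> perp I g -> g@_m = 0.
Proof.
move=> Im /(_ _ Im) /(congr1 (mcoeff 0%MM)).
have := mcoeff_diff_action 'X_[m] g 0%MM.
rewrite mpolyX0 mul1r pairingX mcoeff0 => E E0.
move: E; rewrite E0 mul0r => /esym/eqP; rewrite mulf_eq0 => /orP[/eqP//|].
by rewrite pnatr_eq0 -leqn0 leqNgt mfact_gt0.
Qed.

Lemma sum_lt_exists (a b : V -> nat) :
  (\sum_i a i < \sum_i b i)%N -> exists i, (a i < b i)%N.
Proof.
move=> lt; apply/existsP; apply: contraT => /existsPn ge.
rewrite ltnNge leq_sum // in lt => i _.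
by rewrite leqNgt; apply: ge.
Qed.

(** A lattice point [a] has entries at most [d] with sum [d * l], and the complements [d - a i] have
    sum [d * (n - l)]. A monomial beyond one of the bounds therefore exceeds some [a i] or some
    [d - a i] at every lattice point. *)
Lemma harmonic_degree_bounds (d : nat) g :
    harmonic_space (dilate d P) g ->
  degree_bound (fun=> d) g /\ (msize g <= (d * h).+1)%N.
Proof.
move=> Hg.
have zN z : lattice_points (dilate d P) z ->
    exists2 a : V -> nat, (forall i, z 0 i = (a i)%:Z)
      & (forall i, (a i <= d)%N) /\ (\sum_i a i = d * l)%N.
  move=> /lattice_dilate_hypersimplexP[z01 sz].
  have za i : z 0 i = (absz (z 0 i))%:Z.
    by have /andP[z0 _] := z01 i; rewrite gez0_abs.
  exists (fun i => absz (z 0 i)) => //; split=> [i|].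
    by have /andP[_] := z01 i; rewrite {1}za lez_nat.
  apply/eqP; rewrite -eqz_nat -sz; apply/eqP.
  by rewrite -[LHS]natz natr_sum; apply: eq_bigr => i _; rewrite natz -za.
(* The linear factors vanish at [0, 1, ..., m i - 1]. *)
have low m : (forall a : V -> nat, (forall i, (a i <= d)%N) ->
     (\sum_i a i = d * l)%N -> exists i, (a i < m i)%N) -> g@_m = 0.
  move=> am; apply: mcoeff_perp_monomial Hg.
  refine (@gr_ideal_monomial _ _ (fun _ (x : nat) => x%:R) _) => z /zN[a za [a1 a2]].
  have [i lt_i] := am a a1 a2.
  by exists i, (Ordinal lt_i); rewrite za.
(* The linear factors vanish at [d, d - 1, ..., d - m i + 1]. *)
have high m : (forall a : V -> nat, (forall i, (a i <= d)%N) ->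
     (\sum_i a i = d * l)%N -> exists i, (d - a i < m i)%N) -> g@_m = 0.
  move=> am; apply: mcoeff_perp_monomial Hg.
  refine (@gr_ideal_monomial _ _ (fun _ (x : nat) => d%:R - x%:R) _).
  move=> z /zN[a za [a1 a2]]; have [i lt_i] := am a a1 a2.
  by exists i, (Ordinal lt_i); rewrite za /= natrB // opprB addrC subrK.
split=> [m mg k|].
  rewrite leqNgt; apply: contraL mg => lt_k; rewrite -mcoeff_eq0; apply/eqP.
  by apply: low => a a1 _; exists k; apply: leq_ltn_trans lt_k.
apply/msize_leP => m; rewrite ltnS; apply: contraLR; rewrite -ltnNge => lt_m.
rewrite -mcoeff_eq0; apply/eqP; move: lt_m.
rewrite minnMr gtn_min mdegE => /orP[] lt_m.
  by apply: low => a _ sa; apply: (@sum_lt_exists a (fun i => m i)); rewrite sa.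
apply: high => a a1 sa; apply: (@sum_lt_exists (fun i => d - a i)%N (fun i => m i)).
by rewrite sumnB // sa sum_nat_const card_ord (mulnC n) -mulnBr.
Qed.

(** The sum of the variables minus [d * l] vanishes on the lattice points, and its top component
    acts as [translation_deriv]. *)
Lemma harmonic_translation_deriv (d : nat) g : (0 < n)%N ->
  harmonic_space (dilate d P) g -> translation_deriv g = 0.
Proof.
move=> n_gt0 Hg; pose s : S := \sum_i 'X_i.
have sc k : s@_U_(k) = 1.
  rewrite /s raddf_sum (bigD1 k) //= mcoeffXU eqxx big1 ?addr0 // => i ne.
  by rewrite mcoeffXU (negPf ne).
have <- : diff_action s g = translation_deriv g.
  have uU : uniq [seq U_(k)%MM | k : V].
    by rewrite map_inj_uniq ?enum_uniq // => i j /eqP; rewrite eq_mnm1 => /eqP.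
  rewrite /diff_action.
  rewrite (@big_msupp_widen _ _ (fun m c => c *: g^`M[m]) _ s _ uU); first last.
  - move=> m /msupp_sum_le/flattenP[_ /mapP[k _ ->]].
    by rewrite msuppX inE => /eqP->; apply: map_f; rewrite mem_enum.
  - by move=> m; rewrite scale0r.
  rewrite big_map big_enum /=; apply: eq_bigr => k _.
  by rewrite sc scale1r mderivmU1m.
apply: Hg => J _; apply.
have lf : leading_form 1 (s - (d * l)%:R%:MP) s.
  split; first by apply: rpred_sum => i _; rewrite dhomogX /= mdeg1.
  by rewrite addrAC subrr sub0r msizeN msizeC; case: (_ != _).
have [|nz_f top_f] := leading_form_top _ lf.
  apply/eqP => s0; have := sc (Ordinal n_gt0).
  by rewrite s0 mcoeff0 => /eqP; rewrite eq_sym oner_eq0.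
exists (s - (d * l)%:R%:MP); split=> // z /lattice_dilate_hypersimplexP[_ sz].
rewrite mevalB mevalC /s raddf_sum /=; under eq_bigr do rewrite mevalXU.
by rewrite -rmorph_sum /= sz subrr.
Qed.

(** * Harmonicity of graph monomials *)

Lemma exists_sum_bounded (c : V -> nat) (t : nat) : (t <= \sum_i c i)%N ->
  exists2 u : V -> nat, (forall i, u i <= c i)%N & (\sum_i u i = t)%N.
Proof.
elim: t => [|t IHt] lt_t; first by exists (fun=> 0%N); rewrite ?big1.
have [u uc su] := IHt (ltnW lt_t).
have [k lt_k] : exists k, (u k < c k)%N by apply: sum_lt_exists; rewrite su.
exists (fun i => u i + (k == i))%N => [i|].
  by have [<-|_] := eqVneq k i; rewrite ?addn0 ?addn1.
by rewrite big_split /= su (sum_nat_eq_indicator predT) addn1.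
Qed.

Lemma sum_count_mem (w : seq V) : (\sum_i count_mem i w = size w)%N.
Proof.
elim: w => [|v w IHw]; first by rewrite big1.
by rewrite /= big_split /= IHw (sum_nat_eq_indicator predT).
Qed.

Lemma sum_vdeg E : (\sum_k vdeg E k = (size E).*2)%N.
Proof. by rewrite big_split /= !sum_count_mem !size_map addnn. Qed.

Lemma count_choice_le_vdeg (w : seq V) E k :
  all2 (fun v e => v \in [:: e.1; e.2]) w E -> (count_mem k w <= vdeg E k)%N.
Proof.
elim: w E => [|v w IHw] [|e E] //= /andP[ve /IHw le_w].
rewrite vdeg_cons leq_add //.
by move: ve; rewrite !inE => /orP[]/eqP->; rewrite ?leq_addr ?leq_addl.
Qed.

Lemma graph_monomial_harmonic (d : nat) E :
  bounded_graph h d E -> harmonic_space (dilate d P) (graph_monomial E).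
Proof.
move=> [sE dE] F IF.
apply: diff_action_eq0.
(* Allowing every monomial factor makes the orthogonality condition an ideal, so it can be checked
   on top components. *)
apply: (IF (fun F => forall a, pairing ('X_[a] * F) (graph_monomial E) = 0)).
  split=> [a|p q Jp Jq a|c p Jp a].
  - by rewrite mulr0 pairing0l.
  - by rewrite mulrDr pairingDl Jp Jq addr0.
  - elim/mpolyind: c => [|c m q _ _ IHq]; first by rewrite mul0r mulr0 pairing0l.
    rewrite mulrDl mulrDr pairingDl IHq addr0 -scalerAl -scalerAr pairingZl.
    by rewrite mulrA -mpolyXD Jp mulr0.
move=> _ [f [nz_f Zf ->]] a {F IF}.
have lf := leading_formM (leading_formX a) (top_component_leading_form nz_f).
set D := (_ + _)%N in lf.
have [eD|neD] := eqVneq D (size E); last first.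
  by have [hF _] := lf; apply: pairing_homog_neq hF (graph_monomial_homog E) neD.
have [le1 le2] : (size E <= d * l)%N /\ (size E <= d * (n - l))%N.
  by apply/andP; rewrite -leq_min -minnMr.
(* The base point of the difference operator. It leaves room for the degrees, and its sum lacks one
   unit per edge; it exists because [d * l - size E] is at most [d * n - (size E).*2], that is,
   [size E <= d * (n - l)]. *)
have [u uc su] : exists2 u : V -> nat, (forall i, u i <= d - vdeg E i)%N &
    (\sum_i u i = d * l - size E)%N.
  apply: exists_sum_bounded; rewrite sumnB // sum_vdeg.
  rewrite sum_nat_const card_ord (mulnC n); move: le1 le2.
  rewrite mulnBr; have : (d * l <= d * n)%N by rewrite leq_mul2l le_ln orbT.
  by rewrite -addnn; lia.
apply: (@pairing_leading_form_graph _ E _ _ (fun i => (u i)%:R)).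
  by rewrite -eD; apply: lf.
move=> w wE; rewrite mevalM.
(* The evaluation points of the operator lie in the dilate, where [f] vanishes. *)
pose z : 'rV[int]_n := \row_i (u i + count_mem i w)%N%:Z.
rewrite (_ : f.@[_] = 0) ?mulr0 //.
have <- : f.@[fun i => (z 0 i)%:~R] = 0.
  apply: Zf; apply/lattice_dilate_hypersimplexP; split=> [i|].
    have le_z := leq_add (uc i) (count_choice_le_vdeg i wE).
    rewrite mxE /= lez_nat (leq_trans le_z) //.
    by rewrite subnK.
  under eq_bigr do rewrite mxE.
  under eq_bigr do rewrite -natz.
  rewrite -natr_sum natz big_split /= su sum_count_mem.
  have -> : size w = size E.
    by elim: (w) (E) wE => [|v w' IHw] [|e E'] //= /andP[_ /IHw->].
  by rewrite subnK.
by apply: meval_eq => i; rewrite mxE -pmulrn natrD.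
Qed.

Theorem harmonic_space_graph_span (d : nat) g : (0 < n)%N ->
  harmonic_space (dilate d P) g <-> graph_span (fun=> d) (d * h) g.
Proof.
move=> n_gt0; split=> [Hg|]; last first.
  apply; first exact: perp_subspace.
  by move=> _ [E [sE dE ->]]; apply: graph_monomial_harmonic.
have [bg sg] := harmonic_degree_bounds Hg.
by apply: invariant_graph_span => //; apply: harmonic_translation_deriv Hg.
Qed.

End HarmonicSpace.

(** * The harmonic algebra *)

Section HarmonicAlgebra.

Local Open Scope ring_scope.
Variables (R : realType) (n l : nat).
Hypotheses (n_gt0 : (0 < n)%N) (le_ln : (l <= n)%N).
Local Notation S := {mpoly rat[n]}.
Local Notation A := {mpoly rat[n.+1]}.
Local Notation V := 'I_n.
Local Notation P := (@hypersimplex n R l).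
Local Notation h := (minn l (n - l)).
Implicit Types (E M : seq (V * V)) (v g : S) (F G : A).

Lemma embedD : {morph @embed n : p q / p + q}.
Proof. exact: comp_mpolyD. Qed.

Lemma embedZ c v : embed (c *: v) = c *: embed v.
Proof. exact: comp_mpolyZ. Qed.

Lemma embedM : {morph @embed n : p q / p * q}.
Proof. exact: rmorphM. Qed.

Lemma embed0 : embed (0 : S) = 0.
Proof. exact: comp_mpoly0. Qed.

Lemma embed1 : embed (1 : S) = 1.
Proof. exact: comp_mpoly1. Qed.

Lemma embed_subspace (W : A -> Prop) (F : A) :
  is_subspace W -> is_subspace (fun v => W (F * embed v)).
Proof.
case=> W0 WD WZ; split=> [|p q Wp Wq|c p Wp].
- by rewrite embed0 mulr0.
- by rewrite embedD mulrDr; apply: WD.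
- by rewrite embedZ -scalerAr; apply: WZ.
Qed.

(** These elements span the algebra, so closure under products reduces to concatenation of
    graphs. *)
Definition graph_generator (F : A) : Prop :=
  exists d E, bounded_graph h d E /\ F = 'X_ord0 ^+ d * embed (graph_monomial E).

Lemma graph_generatorM F G :
  graph_generator F -> graph_generator G -> graph_generator (F * G).
Proof.
move=> [d [E [[sE dE] ->]]] [d' [E' [[sE' dE'] ->]]].
exists (d + d')%N, (E ++ E'); split.
  by split=> [|k]; rewrite ?size_cat ?mulnDl ?vdeg_cat leq_add.
by rewrite exprD graph_monomial_cat embedM mulrACA.
Qed.

Lemma lspan_graph_generatorM F G :
    lspan graph_generator F -> lspan graph_generator G ->
  lspan graph_generator (F * G).
Proof.
have [W0 WD WZ] : is_subspace (lspan graph_generator) by apply: lspan_subspace.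
move=> sF sG; apply: (sF (fun F => lspan graph_generator (F * G))).
  split=> [|p q Wp Wq|c p Wp].
  - by rewrite mul0r.
  - by rewrite mulrDl; apply: WD.
  - by rewrite -scalerAl; apply: WZ.
move=> F' gF'; apply: (sG (fun G => lspan graph_generator (F' * G))).
  split=> [|p q Wp Wq|c p Wp].
  - by rewrite mulr0.
  - by rewrite mulrDr; apply: WD.
  - by rewrite -scalerAr; apply: WZ.
by move=> G' gG'; apply: mem_lspan; apply: graph_generatorM.
Qed.

Lemma harmonic_component_subspace d : is_subspace (harmonic_component P d).
Proof.
have [V0 VD VZ] := perp_subspace (gr_ideal (lattice_points (dilate d P))).
split=> [|_ _ [v Vv ->] [w Vw ->]|c _ [v Vv ->]].
- by exists 0; rewrite // embed0 mulr0.
- by exists (v + w); [apply: VD|rewrite embedD mulrDr].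
- by exists (c *: v); [apply: VZ|rewrite embedZ scalerAr].
Qed.

Lemma harmonic_algebra_subspace : is_subspace (harmonic_algebra P).
Proof.
split=> [|_ _ [d [F [cF ->]]] [e [G [cG ->]]]|c _ [d [F [cF ->]]]].
- exists 0%N, (fun=> 0); rewrite big_ord0; split=> // m.
  by have [] := harmonic_component_subspace m.
- pose trunc t (X : nat -> A) m := if (m < t)%N then X m else 0.
  exists (maxn d e), (fun m => trunc d F m + trunc e G m); split=> [m|].
    have [C0 CD _] := harmonic_component_subspace m.
    by apply: CD; rewrite /trunc; case: ifP.
  rewrite big_split /=; congr (_ + _).
    by rewrite -big_mkcond /= (big_ord_narrow (leq_maxl d e)).
  by rewrite -big_mkcond /= (big_ord_narrow (leq_maxr d e)).
- exists d, (fun m => c *: F m); split=> [m|]; last by rewrite scaler_sumr.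
  by have [_ _] := harmonic_component_subspace m; apply.
Qed.

Lemma harmonic_component_algebra d F :
  harmonic_component P d F -> harmonic_algebra P F.
Proof.
move=> cF; exists d.+1, (fun m => if m == d then F else 0); split=> [m|].
  by case: eqP => [->//|_]; have [] := harmonic_component_subspace m.
rewrite big_ord_recr /= eqxx big1 ?add0r // => i _.
by rewrite ltn_eqF.
Qed.

Lemma harmonic_algebra_lspan F :
  harmonic_algebra P F <-> lspan graph_generator F.
Proof.
split=> [[d [G [cG ->]]]|].
  apply: (subspace_sum _ (@lspan_subspace _ _ _)) => m _; have [v Hv ->] := cG m.
  have /harmonic_space_graph_span-/(_ le_ln n_gt0) := Hv.
  move=> /(_ (fun v => lspan graph_generator ('X_ord0 ^+ m * embed v))); apply.
    exact: (embed_subspace _ (@lspan_subspace _ _ _)).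
  by move=> _ [E [sE dE ->]]; apply: mem_lspan; exists (m : nat), E.
apply; first exact: harmonic_algebra_subspace.
move=> _ [d [E [bE ->]]]; apply: (@harmonic_component_algebra d).
by exists (graph_monomial E) => //; apply: graph_monomial_harmonic.
Qed.

Lemma harmonic_algebra_subalgebra : is_subalgebra (harmonic_algebra P).
Proof.
have [_ HD HZ] := harmonic_algebra_subspace; split=> // [|F G HF HG].
  apply/harmonic_algebra_lspan; apply: mem_lspan; exists 0%N, [::]; split=> //.
  by rewrite /graph_monomial big_nil embed1 mulr1.
apply/harmonic_algebra_lspan.
by apply: lspan_graph_generatorM; apply/harmonic_algebra_lspan.
Qed.

(** * Generation in degree one *)

Lemma subalgebra_subspace (B : A -> Prop) : is_subalgebra B -> is_subspace B.
Proof.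
by case=> B1 BZ BD _; split=> //; rewrite -(scale0r 1); apply: BZ.
Qed.

(** A product of [d] matching monomials absorbs [X_0^d] one factor [X_0] at a time, so it is a
    product of [d] elements of the first component. *)
Lemma harmonic_algebra_generated :
  generated_as_algebra_by (harmonic_algebra P) (harmonic_component P 1).
Proof.
move=> F; split=> [/harmonic_algebra_lspan sF B BB gB|]; last first.
  apply; first exact: harmonic_algebra_subalgebra.
  exact: harmonic_component_algebra.
apply: sF; first exact: subalgebra_subspace.
have [B1 _ _ BM] := BB.
have le_hn : (h.*2 <= n)%N.
  by rewrite -addnn -{3}(subnKC le_ln) leq_add ?geq_minl ?geq_minr.
move=> _ [d [E [bE ->]]]; have := span_matching_products le_hn bE.
move=> /(_ (fun v => B ('X_ord0 ^+ d * embed v))); apply.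
  exact/embed_subspace/subalgebra_subspace.
move=> _ [Ms [sMs bMs ->]]; rewrite -{}sMs.
elim: Ms bMs => [|M Ms IHMs] bMs; first by rewrite big_nil embed1 mulr1.
rewrite big_cons embedM exprS mulrACA; apply: BM; last first.
  by apply: IHMs => N NMs; apply: bMs; rewrite inE NMs orbT.
apply: gB; exists (graph_monomial M); last by rewrite expr1.
by apply: graph_monomial_harmonic => //; apply: bMs; rewrite mem_head.
Qed.

(** The first component is spanned by the monomials of graphs with at most [h] edges and degrees at
    most one; as edge lists of bounded length these are finite in number. *)
Lemma harmonic_algebra_finitely_generated :
  finitely_generated_algebra (harmonic_algebra P).
Proof.
pose graphs := [seq E <-
    flatten [seq map val (enum {: k.-tuple (V * V)}) | k <- iota 0 h.+1]
    | [forall k, vdeg E k <= 1]%N].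
have graphsP E : E \in graphs <-> bounded_graph h 1 E.
  rewrite mem_filter /bounded_graph mul1n; split.
    case/andP=> /forallP dE /flattenP[s /mapP[k]]; rewrite mem_iota ltnS => lek ->.
    by case/mapP=> t _ Et; split=> //; rewrite Et size_tuple.
  move=> [sE dE]; apply/andP; split; first exact/forallP.
  apply/flattenP; exists (map val (enum {: (size E).-tuple (V * V)})).
    by apply/mapP; exists (size E); rewrite // mem_iota ltnS.
  by apply/mapP; exists (in_tuple E); rewrite ?mem_enum.
exists [seq 'X_ord0 * embed (graph_monomial E) | E <- graphs] => F.
split=> [/harmonic_algebra_generated gF B BB gB|]; last first.
  apply; first exact: harmonic_algebra_subalgebra.
  move=> _ /mapP[E /graphsP bE ->]; apply: (@harmonic_component_algebra 1).
  by exists (graph_monomial E); rewrite ?expr1 //; apply: graph_monomial_harmonic.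
apply: gF => // _ [v Hv ->]; have /harmonic_space_graph_span-/(_ le_ln n_gt0) := Hv.
move=> /(_ (fun v => B ('X_ord0 ^+ 1 * embed v))); apply.
  exact/embed_subspace/subalgebra_subspace.
move=> _ [E [sE dE ->]]; apply: gB; rewrite expr1; apply: map_f.
exact/graphsP.
Qed.

End HarmonicAlgebra.

Theorem theoremB (R : realType) (l n : nat)
    (hl : 0 < l) (hn : 0 < n) (hln : l <= n) :
  generated_as_algebra_by
    (harmonic_algebra (@hypersimplex n R l))
    (harmonic_component (@hypersimplex n R l) 1)
  /\ finitely_generated_algebra (harmonic_algebra (@hypersimplex n R l)).
Proof.
split; first exact: harmonic_algebra_generated.
exact: harmonic_algebra_finitely_generated.
Qed.
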